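(* Let $(a,b)\subset\mathbb{R}$ be a finite interval, $m,n\in\mathbb{N}$, $\varepsilon_0>0$. For each $\varepsilon\in[0,\varepsilon_0)$ let $A(\cdot;\varepsilon)\in (W^{n-1}_\infty)^{m\times m}$, $f(\cdot;\varepsilon)\in(W^{n-1}_\infty)^m$, $c(\varepsilon)\in\mathbb{C}^m$, and let $B(\varepsilon)\colon (W^n_\infty)^m\to\mathbb{C}^m$ be a bounded linear operator; let $L(\varepsilon)y:=y'+A(\cdot;\varepsilon)y$ and consider the operator $(L(\varepsilon),B(\varepsilon))\colon (W^n_\infty)^m\to (W^{n-1}_\infty)^m\times\mathbb{C}^m$, $y\mapsto(L(\varepsilon)y,B(\varepsilon)y)$. Assume the problem $L(0)y=0$ on $(a,b)$, $B(0)y=0$ has only the trivial solution in $(W^n_\infty)^m$, and that as $\varepsilon\to0+$: 1) $\|A(\cdot;\varepsilon)-A(\cdot;0)\|_{n-1,\infty}\to0$; 2) $B(\varepsilon)y\to B(0)y$ in $\mathbb{C}^m$ for every $y\in(W^n_\infty)^m$. Then for all sufficiently small $\varepsilon>0$ the operator $(L(\varepsilon),B(\varepsilon))$ is invertible. If in addition 3) $\|f(\cdot;\varepsilon)-f(\cdot;0)\|_{n-1,\infty}\to0$ and $c(\varepsilon)\to c(0)$ as $\varepsilon\to0+$, then the solutions $y(\cdot;\varepsilon)$ of $L(\varepsilon)y=f(\cdot;\varepsilon)$, $B(\varepsilon)y=c(\varepsilon)$ satisfy $\|y(\cdot;\varepsilon)-y(\cdot;0)\|_{n,\infty}\to0$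 as $\varepsilon\to0+$.
   Context: For an integer $k\ge0$, $W^k_\infty=W^k_\infty([a,b];\mathbb{C})$ is the Sobolev space of complex functions on $[a,b]$ whose derivatives up to order $k$ are essentially bounded, with norm $\|y\|_{k,\infty}=\sum_{j=0}^k\|y^{(j)}\|_{L_\infty}$; $W^0_\infty=L_\infty$. $(W^k_\infty)^m$, $(W^k_\infty)^{m\times m}$ denote vector/matrix functions with components in $W^k_\infty$, normed componentwise. A solution of $L(\varepsilon)y=f$, $B(\varepsilon)y=c$ is a $y\in(W^n_\infty)^m$ satisfying $y'+A(\cdot;\varepsilon)y=f$ a.e. on $(a,b)$ and $B(\varepsilon)y=c$. *)

(* Defs.v *)
From HB Require Import structures.
From mathcomp Require Import all_boot all_order all_algebra.
From mathcomp Require Import all_classical all_reals all_analysis ess_sup_inf.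
From mathcomp.real_closed Require Import complex.

Set Implicit Arguments.
Unset Strict Implicit.
Unset Printing Implicit Defensive.

Import Order.TTheory GRing.Theory Num.Theory.
Import numFieldNormedType.Exports.
Local Open Scope classical_set_scope.
Local Open Scope ring_scope.

Section Sobolev.
Variable R : realType.
Local Notation C := (R[i]).

Definition cabs (z : C) : R := Num.sqrt ((@complex.Re R z) ^+ 2 + (@complex.Im R z) ^+ 2).

Definition cder (g : R -> C) : R -> C :=
  fun x => Complex (derive1 (fun t => complex.Re (g t)) x)
                    (derive1 (fun t => complex.Im (g t)) x).

Definition cder_n (j : nat) (g : R -> C) : R -> C := iter j cder g.

Definition Linf_norm (a b : R) (g : R -> C) : \bar R :=
  ess_sup (@lebesgue_measure R)
    (fun x => ((if x \in `[a, b] then cabs (g x) else 0)%:E)).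

(* Scalar Sobolev space W^k_oo([a,b]; C), with functions identified with
   their (continuous, for k >= 1) representatives:
   - k = 0: L_oo, i.e. measurable and essentially bounded on [a,b];
   - k >= 1: g continuous on [a,b]; the classical derivatives g^(j),
     j < k-1, exist on (a,b); g^(j) (j < k) extend continuously to [a,b];
     and g^(k-1) is Lipschitz on (a,b) (equivalently: absolutely continuous
     with essentially bounded derivative), so g^(k) exists a.e. *)
Definition W (k : nat) (a b : R) (g : R -> C) : Prop :=
  if k is k'.+1 then
    [/\ {within `[a, b], continuous (fun t => complex.Re (g t))},
        {within `[a, b], continuous (fun t => complex.Im (g t))},
        (forall j, (j < k')%N -> forall x, x \in `]a, b[ ->
            derivable (fun t => complex.Re (cder_n j g t)) x 1 /\
            derivable (fun t => complex.Im (cder_n j g t)) x 1),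
        (forall j, (j < k)%N -> exists h : R -> C,
            {within `[a, b], continuous (fun t => complex.Re (h t))} /\
            {within `[a, b], continuous (fun t => complex.Im (h t))} /\
            (forall x, x \in `]a, b[ -> h x = cder_n j g x)) &
        exists L : R, forall x y, x \in `]a, b[ -> y \in `]a, b[ ->
            cabs (cder_n k' g x - cder_n k' g y) <= L * `|x - y| ]
  else
    [/\ measurable_fun `[a, b] (fun t => complex.Re (g t)),
        measurable_fun `[a, b] (fun t => complex.Im (g t)) &
        (Linf_norm a b g < +oo)%E ].

Definition Wnorm (k : nat) (a b : R) (g : R -> C) : R :=
  \sum_(j < k.+1) fine (Linf_norm a b (cder_n j g)).

Definition Wvec (m k : nat) (a b : R) (y : R -> 'cV[C]_m) : Prop :=
  forall i : 'I_m, W k a b (fun t => y t i ord0).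

Definition Wvec_norm (m k : nat) (a b : R) (y : R -> 'cV[C]_m) : R :=
  \sum_(i < m) Wnorm k a b (fun t => y t i ord0).

Definition Wmat (m k : nat) (a b : R) (A : R -> 'M[C]_m) : Prop :=
  forall i j : 'I_m, W k a b (fun t => A t i j).

Definition Wmat_norm (m k : nat) (a b : R) (A : R -> 'M[C]_m) : R :=
  \sum_(i < m) \sum_(j < m) Wnorm k a b (fun t => A t i j).

Definition cvnorm (m : nat) (c : 'cV[C]_m) : R :=
  \sum_(i < m) cabs (c i ord0).

Definition vder (m : nat) (y : R -> 'cV[C]_m) : R -> 'cV[C]_m :=
  fun x => \col_(i < m) cder (fun t => y t i ord0) x.

Definition Lop (m : nat) (A : R -> 'M[C]_m) (y : R -> 'cV[C]_m)
  : R -> 'cV[C]_m := fun x => vder y x + A x *m y x.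

Definition solves (m n : nat) (a b : R) (A : R -> 'M[C]_m)
    (B : (R -> 'cV[C]_m) -> 'cV[C]_m) (f : R -> 'cV[C]_m) (c : 'cV[C]_m)
    (y : R -> 'cV[C]_m) : Prop :=
  [/\ Wvec n a b y,
      {ae @lebesgue_measure R, forall x, x \in `]a, b[ -> Lop A y x = f x} &
      B y = c].

Definition bounded_linear_op (m n : nat) (a b : R)
    (B : (R -> 'cV[C]_m) -> 'cV[C]_m) : Prop :=
  (forall (al : C) y1 y2, Wvec n a b y1 -> Wvec n a b y2 ->
      B (fun x => al *: y1 x + y2 x) = al *: B y1 + B y2) /\
  (exists K : R, forall y, Wvec n a b y ->
      cvnorm (B y) <= K * Wvec_norm n a b y).

(* (L, B) : (W^n_oo)^m -> (W^{n-1}_oo)^m x C^m is invertible (bijective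
   with bounded inverse); elements of the space are identified when they
   agree a.e. on [a,b]. *)
Definition LB_invertible (m n : nat) (a b : R) (A : R -> 'M[C]_m)
    (B : (R -> 'cV[C]_m) -> 'cV[C]_m) : Prop :=
  [/\ (forall f c, Wvec n.-1 a b f -> exists y, solves n a b A B f c y),
      (forall f c y1 y2, solves n a b A B f c y1 -> solves n a b A B f c y2 ->
          {ae @lebesgue_measure R, forall x, x \in `[a, b] -> y1 x = y2 x}) &
      exists K : R, forall y, Wvec n a b y ->
          Wvec_norm n a b y <=
          K * (Wvec_norm n.-1 a b (Lop A y) + cvnorm (B y))].

End Sobolev.

(* Main.v *)
(* Real and imaginary parts turn y' + A y = f into a real linear system. A
   Lipschitz function is the primitive of its almost everywhere derivative
   (Radon-Nikodym applied to a Stieltjes measure), so the system is equivalent to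
   an integral equation; Picard iteration in an exponentially weighted norm
   solves it, and the same weight gives ||y||_n <= K (||Ly||_(n-1) + |y(a)|) with K
   depending on A only through a bound of its norm. Hence the fundamental
   matrix Y(e), normalized at a, converges to Y(0) in norm. The B(e) converge
   pointwise, so they are uniformly bounded for small e, by a gliding hump along
   a sequence of parameters, and the m x m matrices B(e)Y(e) converge to B(0)Y(0),
   which is invertible because the limit problem has only the trivial solution.
   A lower bound for B(e)Y(e) then gives the stability estimate
   ||y||_n <= K (||L(e)y||_(n-1) + |B(e)y|), uniform in small e; applied to
   y(e) - y(0) it proves the convergence. *)

(* [Wnorm] is a sum of essential suprema of pointwise derivatives, awkward to compute with.
   Estimates are therefore carried by [bd k M], where one number bounds a function and its chosen
   derivatives up to order [k]; sums, products, primitives and geometric limits keep explicit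
   constants in it. Going from [bd] to the norm costs a factor depending on [m] and the order; going
   back costs a change of representative on a null set. Uniformity in the parameter rests on the
   order of quantifiers: the a priori constant is fixed before the coefficients, knowing only their
   bound. The [B(e)] converge pointwise and not in operator norm, so the boundary problems are
   compared only through m x m matrices: B(e)Y(e) - B(0)Y(0) splits into B(e)(Y(e) - Y(0)), small by
   the uniform bound on B(e), and (B(e) - B(0))Y(0), which involves finitely many fixed functions.
   The ratio 1/4 serves twice: it is the contraction factor of the weighted iteration, and in the
   gliding hump it makes the tail after each step at most half of that step. *)
Require Import Defs.
From HB Require Import structures.
From mathcomp Require Import all_boot all_order all_algebra.
From mathcomp Require Import all_classical all_reals all_analysis ess_sup_inf measurable_realfun.
From mathcomp.real_closed Require Import complex.
From mathcomp Require Import ring lra.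
Import Order.TTheory GRing.Theory Num.Theory.
Import numFieldNormedType.Exports.
Local Open Scope classical_set_scope.
Local Open Scope ring_scope.
Set Implicit Arguments.
Unset Strict Implicit.
Unset Printing Implicit Defensive.

(** * Primitives of bounded measurable functions *)

Section AlmostEverywhere.
Context {R : realType}.
Notation mu := (@lebesgue_measure R).
Implicit Types P Q S T : R -> Prop.

Lemma aeS P Q : (forall x, P x -> Q x) ->
  {ae mu, forall x, P x} -> {ae mu, forall x, Q x}.
Proof. by move=> PQ [N [mN N0 PN]]; exists N; split=> // x nQ; apply: PN => /PQ. Qed.

Lemma aeS2 P Q S : (forall x, P x -> Q x -> S x) ->
  {ae mu, forall x, P x} -> {ae mu, forall x, Q x} -> {ae mu, forall x, S x}.
Proof.
move=> PQS aP aQ; apply: (@aeS (fun x => P x /\ Q x)) => [x []|]; first exact: PQS.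
by apply: negligibleS (negligibleU aP aQ) => x /= /not_andP.
Qed.

Lemma aeS3 P Q S T : (forall x, P x -> Q x -> S x -> T x) ->
  {ae mu, forall x, P x} -> {ae mu, forall x, Q x} -> {ae mu, forall x, S x} ->
  {ae mu, forall x, T x}.
Proof.
by move=> H aP aQ; apply: aeS2 (aeS2 (fun x p q => conj p q) aP aQ) => x [] /H; apply.
Qed.

Lemma aeT P : (forall x, P x) -> {ae mu, forall x, P x}.
Proof. by move=> PT; apply: aeW. Qed.

Lemma ae_neq c : {ae mu, forall x, x != c}.
Proof.
exists [set c]; split => //; first exact: lebesgue_measure_set1.
by move=> z /= /negP; rewrite negbK => /eqP.
Qed.

Lemma ae_itv_oo_cc a b P : {ae mu, forall x, x \in `]a, b[ -> P x} ->
  {ae mu, forall x, x \in `[a, b] -> P x}.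
Proof.
apply: (aeS3 _ (ae_neq a) (ae_neq b)) => x xa xb.
by rewrite !in_itv/= !le_eqVlt [a == x]eq_sym (negbTE xa) (negbTE xb).
Qed.

Lemma ae_itv_cc_oo a b P : {ae mu, forall x, x \in `[a, b] -> P x} ->
  {ae mu, forall x, x \in `]a, b[ -> P x}.
Proof. by apply: aeS => x + /subset_itv_oo_cc; apply. Qed.

Lemma ae_fin (I : finType) (P : I -> R -> Prop) :
  (forall i, {ae mu, forall x, P i x}) -> {ae mu, forall x, forall i, P i x}.
Proof.
move=> aP; suff H (s : seq I) : {ae mu, forall x, forall i, i \in s -> P i x}.
  apply: (@aeS (fun x => forall i, i \in enum I -> P i x) _ _ (H _)) => x Px i.
  by apply: Px; rewrite mem_enum.
elim: s => [|j s IH]; first exact: aeT.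
apply: (@aeS2 _ (fun x => forall i, i \in s -> P i x) _ _ (aP j) IH) => x pj ps i.
by rewrite inE => /orP[/eqP->|/ps].
Qed.

(** An interval of positive length cannot lie in the null set off which [P] holds. *)
Lemma ae_itv_dense (P : R -> Prop) (c d : R) : c < d ->
  {ae mu, forall x, P x} -> exists2 x, x \in `]c, d[ & P x.
Proof.
move=> cd [N [mN N0 PN]]; apply: contrapT => nex.
have sub : `]c, d[%classic `<=` N.
  by move=> x xcd; apply: PN => Px; apply: nex; exists x.
have : mu `]c, d[ = 0 by apply: subset_measure0 N0.
rewrite lebesgue_measure_itv/= lte_fin cd -EFinB => -[] /eqP.
by rewrite subr_eq0 gt_eqF.
Qed.

End AlmostEverywhere.

Section Primitive.
Context {R : realType} (a b : R).
Notation mu := (@lebesgue_measure R).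
Implicit Types (g h u v : R -> R) (x y M : R).

(** The bound holds at every point of the interval; an essentially bounded function is brought to
    this form by truncation with [clamp]. *)
Definition bmeas M h :=
  measurable_fun `[a, b] h /\ forall x, x \in `[a, b] -> `|h x| <= M.

Definition prim h x : R := (\int[mu]_(t in `[a, x]) h t)%R.

Lemma subset_itv_le x : x \in `[a, b] -> `[a, x] `<=` `[a, b].
Proof. by rewrite in_itv/= => /andP[_ xb]; apply: subset_itvl; rewrite bnd_simp. Qed.

Lemma bmeas_ge0 M h : a <= b -> bmeas M h -> 0 <= M.
Proof.
by move=> ab [_ /(_ a)]; rewrite in_itv/= lexx ab => /(_ isT); exact: le_trans.
Qed.

Lemma bmeas_le M N h : M <= N -> bmeas M h -> bmeas N h.
Proof. by move=> MN [mh hM]; split=> // x /hM /le_trans; apply. Qed.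

Lemma bmeas_eq M g h : {in `[a, b], g =1 h} -> bmeas M g -> bmeas M h.
Proof.
move=> gh [mg gM]; split => [|x xab]; last by rewrite -gh ?gM.
by apply: eq_measurable_fun mg => x /set_mem/= xab; apply: gh.
Qed.

Lemma bmeasD M N g h : bmeas M g -> bmeas N h -> bmeas (M + N) (fun x => g x + h x).
Proof.
move=> [mg gM] [mh hN]; split; first exact: measurable_funD.
by move=> x xab; rewrite (le_trans (ler_normD _ _))// lerD ?gM ?hN.
Qed.

Lemma bmeasM M N g h : bmeas M g -> bmeas N h -> bmeas (M * N) (fun x => g x * h x).
Proof.
move=> [mg gM] [mh hN]; split; first exact: measurable_funM.
by move=> x xab; rewrite normrM ler_pM ?gM ?hN.
Qed.

Lemma bmeas_cst c : bmeas `|c| (fun=> c).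
Proof. by split. Qed.

Lemma bmeas_integrable M h : bmeas M h -> mu.-integrable `[a, b] (EFin \o h).
Proof.
move=> [mh hM]; apply: measurable_bounded_integrable => //=.
  by rewrite lebesgue_measure_itv/=; case: ifPn => // _; rewrite -EFinB ltry.
exists M; split; first exact: num_real.
by move=> N MN x /= xab; rewrite (le_trans (hM _ xab))// ltW.
Qed.

Lemma bmeas_integrable_sub M h x y : x \in `[a, b] -> y \in `[a, b] -> bmeas M h ->
  mu.-integrable `[x, y] (EFin \o h).
Proof.
rewrite !in_itv/= => /andP[ax xb] /andP[ay yb] hM.
apply: integrableS (bmeas_integrable hM) => //.
by apply: subset_itv; rewrite bnd_simp.
Qed.

Lemma prim_a h : prim h a = 0.
Proof. by rewrite /prim set_itv1 Rintegral_set1. Qed.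

Let a_in : forall x, x \in `[a, b] -> a \in `[a, b].
Proof. by move=> x; rewrite !in_itv/= lexx => /andP[/le_trans h /h]. Qed.

Lemma primD M N g h x : x \in `[a, b] -> bmeas M g -> bmeas N h ->
  prim (fun t => g t + h t) x = prim g x + prim h x.
Proof.
move=> xab gM hN; rewrite /prim RintegralD//.
- exact: (bmeas_integrable_sub (a_in xab) xab gM).
- exact: (bmeas_integrable_sub (a_in xab) xab hN).
Qed.

Lemma primZ M h c x : x \in `[a, b] -> bmeas M h ->
  prim (fun t => c * h t) x = c * prim h x.
Proof.
move=> xab hM; rewrite /prim RintegralZl//.
exact: (bmeas_integrable_sub (a_in xab) xab hM).
Qed.

Lemma le_prim M N g h x : x \in `[a, b] -> bmeas M g -> bmeas N h ->
  (forall t, t \in `[a, b] -> g t <= h t) -> prim g x <= prim h x.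
Proof.
move=> xab gM hN gh; apply: le_Rintegral => //.
- exact: (bmeas_integrable_sub (a_in xab) xab gM).
- exact: (bmeas_integrable_sub (a_in xab) xab hN).
- by move=> t tx; apply/gh/(subset_itv_le xab).
Qed.

Lemma normr_prim_le M N g h x : x \in `[a, b] -> bmeas M g -> bmeas N h ->
  (forall t, t \in `[a, b] -> `|g t| <= h t) -> `|prim g x| <= prim h x.
Proof.
move=> xab gM hN gh; rewrite ler_norml; apply/andP; split; last first.
  by apply: le_prim gM hN _ => // t /gh; rewrite ler_norml => /andP[].
rewrite -mulN1r -(primZ _ _ hN)//; apply: (le_prim xab _ gM).
  by apply: bmeasM hN; exact: bmeas_cst.
by move=> t /gh; rewrite ler_norml mulN1r => /andP[].
Qed.

Lemma eq_prim g h x : x \in `[a, b] -> {in `[a, b], g =1 h} -> prim g x = prim h x.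
Proof.
by move=> xab gh; apply: eq_Rintegral => t /set_mem/= /(subset_itv_le xab)/gh.
Qed.

Lemma ae_eq_prim g h x : x \in `[a, b] ->
  measurable_fun `[a, b] g -> measurable_fun `[a, b] h ->
  {ae mu, forall x, x \in `]a, b[ -> g x = h x} -> prim g x = prim h x.
Proof.
move=> xab mg mh gh; rewrite /prim /Rintegral; congr fine.
have sub := subset_itv_le xab.
apply: ae_eq_integral => //.
- by apply/measurable_EFinP; apply: (measurable_funS _ sub mg).
- by apply/measurable_EFinP; apply: (measurable_funS _ sub mh).
- by apply: (aeS _ (ae_itv_oo_cc gh)) => t + /sub tab; move=> ->.
Qed.

Lemma prim_lip M h x y : bmeas M h -> x \in `[a, b] -> y \in `[a, b] ->
  `|prim h x - prim h y| <= M * `|x - y|.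
Proof.
move=> hM; wlog yx : x y / y <= x.
  move=> H xab yab; have [|/ltW] := leP y x; first by move=> /H; apply.
  by move=> /H; rewrite (distrC (prim _ _)) (distrC x); apply.
move=> xab yab; rewrite /prim.
have ya : a <= y by move: yab; rewrite in_itv/= => /andP[].
have ix := bmeas_integrable_sub (a_in xab) xab hM.
rewrite Rintegral_itvB ?bnd_simp//.
have sub : `]y, x] `<=` `[a, x].
  by apply: subset_itvr; rewrite bnd_simp.
have iyx : mu.-integrable `]y, x] (EFin \o h) by exact: integrableS ix.
apply: (le_trans (le_normr_Rintegral _ iyx)) => //.
have -> : M * `|x - y| = (\int[mu]_(t in `]y, x]) M)%R.
  rewrite Rintegral_cst//= lebesgue_measure_itv/= lte_fin.
  move: yx; rewrite le_eqVlt => /predU1P[->|yx]; first by rewrite subrr normr0 ltxx.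
  by rewrite yx/= ger0_norm// subr_ge0 ltW.
apply: le_Rintegral => //=.
- by apply/integrable_norm.
- apply: measurable_bounded_integrable => //=; last exact: bounded_cst.
  by rewrite lebesgue_measure_itv/=; case: ifPn => // _; rewrite -EFinB ltry.
- by move=> t /sub/(subset_itv_le xab); exact: hM.2.
Qed.

End Primitive.

(** * Differentiation of primitives *)

Section PrimitiveDerivative.
Context {R : realType} (a b : R).
Notation mu := (@lebesgue_measure R).
Implicit Types (g h u v : R -> R) (x y M : R).

Lemma nbhs_itv_oo x : x \in `]a, b[ -> \forall t \near x, t \in `]a, b[.
Proof.
move=> xab; have : nbhs x `]a, b[%classic by apply: open_nbhs_nbhs; split; [exact: interval_open|].
by apply: filterS.
Qed.

Lemma derivable_itv_oo u v x : x \in `]a, b[ -> {in `]a, b[, u =1 v} ->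
  derivable u x 1 -> derivable v x 1.
Proof.
move=> xab uv; apply: near_eq_derivable => //.
by apply: filterS (nbhs_itv_oo xab) => t /uv.
Qed.

Lemma derive1_itv_oo u v x : x \in `]a, b[ -> {in `]a, b[, u =1 v} ->
  derive1 u x = derive1 v x.
Proof.
move=> xab uv; rewrite !derive1E; apply: near_eq_derive => //.
by apply: filterS (nbhs_itv_oo xab) => t /uv.
Qed.

Lemma is_derive_derive1 u x : derivable u x 1 -> is_derive x 1 u (derive1 u x).
Proof. by move=> du; rewrite derive1E; exact: DeriveDef. Qed.

Lemma is_derive_addl (c df : R) u x : derivable u x 1 -> derive1 u x = df ->
  is_derive x 1 (fun t => c + u t) df.
Proof.
move=> /is_derive_derive1 + dfE; rewrite dfE => du; rewrite -[df]add0r.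
exact: (is_deriveD (f := cst c)).
Qed.

Lemma prim_derivable_ae h : mu.-integrable `[a, b] (EFin \o h) ->
  {ae mu, forall x, x \in `]a, b[ ->
    derivable (prim a h) x 1 /\ derive1 (prim a h) x = h x}.
Proof.
move=> ih; have lh := integrable_locally (measurable_itv _) ih.
(* [FTC1] is given integrability up to every endpoint [y], also beyond [b]; for this [h] is cut off
   to zero outside [[a, b]]. *)
have iT : mu.-integrable setT (EFin \o (h \_ `[a, b])).
  by rewrite -restrict_EFin; apply/integrable_restrict => //=; rewrite setTI.
have iy y : mu.-integrable [set` Interval (BLeft a) (BRight y)] (EFin \o (h \_ `[a, b])).
  exact: integrableS iT.
apply: (aeS _ (FTC1 iy lh)) => x H xab.
have [] := H; first by move: xab; rewrite in_itv/= => /andP[ax _]; rewrite lte_fin.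
have E : {in `]a, b[, (fun x0 => (\int[mu]_(t in [set` Interval (BLeft a) (BRight x0)])
      (h \_ `[a, b]) t)%R) =1 prim a h}.
  move=> t tab; apply: eq_prim (subset_itv_oo_cc tab) _ => s sab.
  by rewrite patchE mem_set.
move=> d1 d2; split; first exact: derivable_itv_oo xab E d1.
by rewrite -(derive1_itv_oo xab E) d2 patchE mem_set//=; exact: subset_itv_oo_cc.
Qed.

Lemma continuous_bmeas v : {within `[a, b], continuous v} -> exists M, bmeas a b M v.
Proof.
move=> cv; have mv : measurable_fun `[a, b] v by exact: subspace_continuous_measurable_fun.
have /compact_bounded[M [_ HM]] := continuous_compact cv (@segment_compact _ a b).
exists (M + 1); split=> // x xab; apply: (HM (M + 1)); first by rewrite ltrDl.
by exists x.
Qed.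

Lemma prim_derivable h x : {within `[a, b], continuous h} -> x \in `]a, b[ ->
  derivable (prim a h) x 1 /\ derive1 (prim a h) x = h x.
Proof.
move=> ch xab; have [M hM] := continuous_bmeas ch.
have /andP[ax xb] : a < x < b by move: xab; rewrite in_itv.
apply: (continuous_FTC1_closed xb (bmeas_integrable hM) ax).
exact: within_continuous_continuous (lt_trans ax xb) ch xab.
Qed.

Lemma prim_FTC u v x : {within `[a, b], continuous u} ->
  {within `[a, b], continuous v} ->
  {in `]a, b[, forall t, derivable u t 1 /\ derive1 u t = v t} ->
  x \in `[a, b] -> u x = u a + prim a v x.
Proof.
move=> cu cv duv xab; have := xab; rewrite in_itv/= le_eqVlt => /andP[/predU1P[<-|ax] xb].
  by rewrite prim_a addr0.
have sub : `[a, x] `<=` `[a, b] := subset_itv_le xab.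
have sub' : {subset `]a, x[ <= `]a, b[} by apply/subset_itvl; rewrite bnd_simp.
have cux := continuous_subspaceW sub cu.
rewrite /prim /Rintegral (@continuous_FTC2 _ v u)//=; first by rewrite subrKC.
- exact: continuous_subspaceW sub cv.
- have /continuous_within_itvP[//|c1 c2 c3] := cux; split=> // t tax.
  by have [] := duv _ (sub' _ tax).
- by move=> t tax; have [] := duv _ (sub' _ tax).
Qed.

End PrimitiveDerivative.

(** * Density of a monotone Lipschitz function *)

Section LipschitzPrimitive.
Context {R : realType} (a b : R).
Notation mu := (@lebesgue_measure R).
Implicit Types (F g h u v : R -> R) (x y M : R).

Lemma lipschitz_continuous K g :
  (forall x y, `|g x - g y| <= K * `|x - y|) -> continuous g.
Proof.
move=> gK x; apply/cvgrPdist_le => /= e e0.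
have K1 : 0 < `|K| + 1 by rewrite ltr_wpDl.
near=> t; rewrite (le_trans (gK _ _))//.
rewrite (@le_trans _ _ ((`|K| + 1) * `|x - t|))//.
  by rewrite ler_wpM2r// (le_trans (ler_norm K))// lerDl.
rewrite mulrC -ler_pdivlMr//; near: t.
by apply: (@cvgr_dist_le _ _ _ _ _ idfun) => //; rewrite divr_gt0.
Unshelve. all: by end_near. Qed.

Lemma stieltjes_itvoc (F : cumulative R R) x y : x <= y ->
  lebesgue_stieltjes_measure F `]x, y]%classic = (F y - F x)%:E.
Proof.
move=> xy; rewrite /lebesgue_stieltjes_measure /measure_extension/=.
by rewrite measurable_mu_extE/= ?wlength_itv_bnd//; exact: is_ocitv.
Qed.

(* The Stieltjes measures of [F] and [id - F] add up to the Lebesgue measure,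
   so the former is absolutely continuous. *)
Lemma monotone_lipschitz_density F :
  (forall x y, x <= y -> 0 <= F y - F x <= y - x) ->
  exists2 d : R -> R, mu.-integrable `[a, b] (EFin \o d) &
    forall x, x \in `[a, b] -> F x = F a + prim a d x.
Proof.
move=> Flip.
have lip G : (forall x y, x <= y -> 0 <= G y - G x <= y - x) -> continuous G.
  move=> Glip; apply: (@lipschitz_continuous 1) => x y; rewrite mul1r.
  wlog xy : x y / x <= y.
    by move=> H; have [/H//|/ltW/H] := leP x y; rewrite distrC (distrC x).
  have /andP[G0 G1] := Glip _ _ xy.
  by rewrite distrC (distrC x) ger0_norm// ger0_norm// subr_ge0.
pose G x := x - F x.
have Glip x y : x <= y -> 0 <= G y - G x <= y - x.
  by move=> /Flip; rewrite /G => ?; lra.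
have nd H : (forall x y, x <= y -> 0 <= H y - H x <= y - x) -> nondecreasing H.
  by move=> Hlip x y /Hlip /andP[]; rewrite subr_ge0.
pose Fc : cumulative R R := HB.pack F
  (isCumulative.Build R _ R F (nd _ Flip) (right_continuousW (lip _ Flip))).
pose Gc : cumulative R R := HB.pack G
  (isCumulative.Build R _ R G (nd _ Glip) (right_continuousW (lip _ Glip))).
pose nu : {measure set (measurableTypeR R) -> \bar R} :=
  lebesgue_stieltjes_measure Fc.
have nu_le A : measurable A -> (nu A <= mu A)%E.
  move=> mA.
  suff -> : mu A = measure_add nu (lebesgue_stieltjes_measure Gc) A.
    by rewrite measure_addE leeDl.
  apply: lebesgue_measure_unique => //.
  move=> X /ocitvP[->|[[x y] /= xy ->]]; first by rewrite !measure0.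
  transitivity (nu `]x, y]%classic + lebesgue_stieltjes_measure Gc `]x, y]%classic)%E;
    last exact/esym/measure_addE.
  rewrite /nu /lebesgue_measure !stieltjes_itvoc ?ltW//=.
  rewrite (stieltjes_itvoc Fc (ltW xy)).
  by rewrite -?EFinD; congr EFin; rewrite /= /G; ring.
have nuoo : (nu `[a, b]%classic < +oo)%E.
  apply: le_lt_trans (nu_le _ (measurable_itv _)) _.
  by rewrite lebesgue_measure_itv/=; case: ifPn => // _; rewrite -EFinB ltry.
(* Restricting [nu] to [[a, b]] gives the finite measure to which Radon-Nikodym is applied. *)
pose nu' : {finite_measure set (measurableTypeR R) -> \bar R} :=
  @mfrestr _ (measurableTypeR R) R `[a, b]%classic nu (measurable_itv _) nuoo.
have dom : charge_of_finite_measure nu' `<< mu.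
  apply/null_content_dominatesP => A mA A0; apply/eqP.
  rewrite -measure_le0 /= /nu' /mfrestr /mrestr -A0.
  apply: (le_trans (nu_le _ _)); first exact: measurableI.
  by apply: le_measure; rewrite ?inE//; exact: measurableI.
pose D := Radon_Nikodym (charge_of_finite_measure nu') mu.
have Dfin x : D x \is a fin_num by exact: Radon_Nikodym_fin_num.
have fineD : EFin \o (fine \o D) = D by apply/funext => x /=; rewrite fineK.
have iD : mu.-integrable `[a, b] D.
  by apply: integrableS (Radon_Nikodym_integrable dom).
exists (fine \o D); first by rewrite fineD.
move=> x xab; have ax : a <= x by move: xab; rewrite in_itv => /andP[].
apply/eqP; rewrite addrC -subr_eq; apply/eqP.
rewrite /prim /Rintegral -(@integral_itv_obnd_cbnd _ a); last first.
  rewrite [X in measurable_fun _ X]fineD; apply: measurable_funS (measurable_int _ iD) => //.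
  by apply: subset_trans (subset_itv_le xab); exact: subset_itv_oc_cc.
rewrite (_ : (fun x => _) = D); last by rewrite -[RHS]fineD.
rewrite -Radon_Nikodym_integral//= /nu' /mfrestr /mrestr.
rewrite setIidl ?stieltjes_itvoc//.
by apply: subset_trans (subset_itv_le xab); exact: subset_itv_oc_cc.
Qed.

End LipschitzPrimitive.

(** * Lipschitz functions are primitives *)

Section Clamp.
Context {R : realType}.
Implicit Types (l u x y : R).

(** Used in two roles: on the argument it extends a function from [[a, b]] to the line by its
    boundary values, on the value it truncates. *)
Definition clamp l u x := Num.max l (Num.min x u).

Lemma clamp_itv l u x : l <= u -> clamp l u x \in `[l, u].
Proof. by move=> lu; rewrite in_itv/= /clamp le_max lexx ge_max lu ge_min lexx orbT. Qed.

Lemma clamp_id l u x : x \in `[l, u] -> clamp l u x = x.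
Proof. by rewrite in_itv/= /clamp => /andP[lx xu]; rewrite (min_idPl xu) (max_idPr lx). Qed.

Lemma clamp_lip l u x y : `|clamp l u x - clamp l u y| <= `|x - y|.
Proof.
have maxL p q : `|Num.max l p - Num.max l q| <= `|p - q|.
  wlog qp : p q / q <= p.
    by move=> H; have [/H//|/ltW/H] := leP q p; rewrite distrC (distrC p).
  rewrite (@ger0_norm _ (p - q)) ?subr_ge0// ger0_norm ?subr_ge0 ?le_max2//.
  by rewrite /Num.max; case: ifP => lp; case: ifP => lq; lra.
have minL p q : `|Num.min p u - Num.min q u| <= `|p - q|.
  wlog qp : p q / q <= p.
    by move=> H; have [/H//|/ltW/H] := leP q p; rewrite distrC (distrC p).
  rewrite (@ger0_norm _ (p - q)) ?subr_ge0// ger0_norm ?subr_ge0 ?le_min2//.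
  by rewrite /Num.min; case: ifP => lp; case: ifP => lq; lra.
exact: le_trans (maxL _ _) (minL _ _).
Qed.

End Clamp.

Section Rademacher.
Context {R : realType} (a b : R).
Notation mu := (@lebesgue_measure R).
Implicit Types (F g h u v : R -> R) (x y K M : R).

Lemma clamp_bmeas h M : 0 <= M -> measurable_fun `[a, b] h ->
  bmeas a b M (fun x => clamp (- M) M (h x)).
Proof.
move=> M0 mh; split; last first.
  move=> x _; rewrite ler_norml.
  by have := @clamp_itv _ (- M) M (h x); rewrite in_itv/=; apply; lra.
by apply: measurable_maxr => //; apply: measurable_minr.
Qed.

Lemma normr_derive1_le u K x : x \in `]a, b[ -> derivable u x 1 ->
  (forall t, t \in `]a, b[ -> `|u t - u x| <= K * `|t - x|) -> `|derive1 u x| <= K.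
Proof.
move=> xab du uK; rewrite derive1E /derive; move: du; rewrite /derivable.
set phi := (fun h : R => _) => cphi.
have near_le : \forall h \near 0^', `|phi h| <= K.
  have H : \forall h \near 0^', h + x \in `]a, b[.
    apply: nbhs_dnbhs.
    have : h + x @[h --> 0] --> 0 + x by apply: cvgD; [exact: cvg_id|exact: cvg_cst].
    by rewrite add0r => /(_ _ (nbhs_itv_oo xab)).
  near=> h; have h0 : h != 0 by near: h; exact: nbhs_dnbhs_neq.
  rewrite /phi /= normrZ normfV mulrC ler_pdivrMr ?normr_gt0// [h *: 1]mulr1.
  have hab : h + x \in `]a, b[ by near: h.
  by have := uK _ hab; rewrite addrK.
rewrite ler_norml; apply/andP; split.
  apply: limr_ge => //; near=> h.
  have : `|phi h| <= K by near: h.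
  by rewrite ler_norml => /andP[].
apply: limr_le => //; near=> h.
have : `|phi h| <= K by near: h.
by rewrite ler_norml => /andP[].
Unshelve. all: by end_near. Qed.

Hypothesis ab : a < b.

(** [F = x / 2 + g / (2 K)], with [g] extended by its boundary values, has increments between 0 and
    those of [x], hence a density [d]; then [K (2 d - 1)] is a density of [g]. Almost everywhere it
    is the derivative of its own primitive, whose difference quotients are those of [g] and are
    bounded by [K]. Truncation to [[- K, K]] thus changes it only on a null set and gives the bound
    at every point. *)
Lemma lipschitz_prim K g :
  (forall x y, x \in `[a, b] -> y \in `[a, b] -> `|g x - g y| <= K * `|x - y|) ->
  exists2 h, bmeas a b K h & forall x, x \in `[a, b] -> g x = g a + prim a h x.
Proof.
move=> gK; have aab : a \in `[a, b] by rewrite in_itv/= lexx ltW.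
have bab : b \in `[a, b] by rewrite in_itv/= lexx ltW.
have : 0 <= K.
  rewrite -(@pmulr_lge0 _ `|b - a|) ?normr_gt0 ?subr_eq0 ?gt_eqF//.
  by apply: le_trans (gK b a bab aab).
(* The construction divides by [K]; for [K = 0] the function is constant. *)
rewrite le_eqVlt => /predU1P[K0|K0].
  exists (fun=> 0).
    by have := bmeas_cst a b (0 : R); rewrite normr0 K0.
  move=> x xab; have := gK _ _ xab aab; rewrite -K0 mul0r normr_le0 subr_eq0 => /eqP ->.
  by rewrite /prim Rintegral_cst// mul0r addr0.
pose c := clamp a b.
have cab x : c x \in `[a, b] by exact: clamp_itv (ltW ab).
pose F x := x / 2 + g (c x) / (2 * K).
have [x y xy|d id dP] := @monotone_lipschitz_density _ a b F.
  have : `|g (c y) - g (c x)| <= K * `|y - x|.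
    by rewrite (le_trans (gK _ _ _ _))// ler_pM2l// clamp_lip.
  rewrite -ler_pdivrMl// -[K^-1]gtr0_norm ?invr_gt0// -normrM.
  rewrite (@ger0_norm _ (y - x)); last by rewrite subr_ge0.
  rewrite ler_norml => H; set p := g (c x); set q := g (c y).
  have -> : F y - F x = (y - x) / 2 + (K^-1 * (q - p)) / 2.
    by rewrite /F -/p -/q; field; exact: lt0r_neq0.
  move: H; rewrite -/p -/q; set z := K^-1 * _; move: z => z /andP[? ?]; lra.
pose e x := K * (2 * d x - 1).
have i1 r : mu.-integrable `[a, b] (EFin \o cst r).
  exact: bmeas_integrable (bmeas_cst _ _ r).
have i2 : mu.-integrable `[a, b] (EFin \o (fun x => 2 * d x)).
  exact: (@integrableZl _ _ _ mu _ (measurable_itv _) 2 (EFin \o d) id).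
have i3 : mu.-integrable `[a, b] (EFin \o (fun x => 2 * d x - 1)).
  exact: (@integrableB _ _ _ mu _ (measurable_itv _)
    (EFin \o (fun x => 2 * d x)) (EFin \o cst 1) i2 (i1 1)).
have ie : mu.-integrable `[a, b] (EFin \o e).
  exact: (@integrableZl _ _ _ mu _ (measurable_itv _) K _ i3).
have Pe x : x \in `[a, b] -> g x = g a + prim a e x.
  move=> xab; have S := subset_itv_le xab.
  have iS h : mu.-integrable `[a, b] (EFin \o h) -> mu.-integrable `[a, x] (EFin \o h).
    exact: integrableS.
  rewrite /prim RintegralZl//; last exact: iS.
  rewrite RintegralB//; [|exact: iS..|exact: (iS _ (i1 _))].
  rewrite RintegralZl//; last exact: iS.
  rewrite Rintegral_cst//= lebesgue_measure_itv/= lte_fin.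
  have -> : fine (if a < x then (x%:E - a%:E)%E else 0%E) = x - a.
    move: xab; rewrite in_itv/= le_eqVlt => /andP[/predU1P[->|->]//].
    by rewrite ltxx subrr.
  have E : g x / (2 * K) = a / 2 + g a / (2 * K) + prim a d x - x / 2.
    by have := dP _ xab; rewrite /F /c !clamp_id// => H; lra.
  have -> : g x = 2 * K * (g x / (2 * K)) by field; exact: lt0r_neq0.
  by rewrite E /prim; field; exact: lt0r_neq0.
have me : measurable_fun `[a, b] e by apply/measurable_EFinP; exact: measurable_int ie.
exists (fun x => clamp (- K) K (e x)); first exact: clamp_bmeas (ltW K0) me.
move=> x xab; rewrite Pe//; congr (_ + _).
have [mc _] := clamp_bmeas (ltW K0) me; apply: (ae_eq_prim xab me mc).
apply: (aeS _ (prim_derivable_ae ie)) => t H tab; have [d1 d2] := H tab.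
rewrite clamp_id// in_itv/= -ler_norml -d2; apply: normr_derive1_le d1 _ => // s sab.
have tab' := subset_itv_oo_cc tab; have sab' := subset_itv_oo_cc sab.
have -> : prim a e s - prim a e t = g s - g t by rewrite (Pe s)// (Pe t)//; ring.
exact: gK.
Qed.

End Rademacher.

(** * Functions with bounded derivatives *)

Section BoundedDerivatives.
Context {R : realType} (a b : R).
Hypothesis ab : a < b.
Notation mu := (@lebesgue_measure R).
Implicit Types (g h u v : R -> R) (x y K M N : R) (k : nat).

(* The derivatives in [bd] are chosen functions on the closed interval, bounded
   everywhere, instead of iterates of [derive1]: neither null sets nor junk
   values at the endpoints intervene. *)
Fixpoint bd k M g : Prop :=
  if k is k'.+1 then
    (forall x, x \in `[a, b] -> `|g x| <= M) /\
    exists2 h, bd k' M h & forall x, x \in `[a, b] -> g x = g a + prim a h x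
  else bmeas a b M g.

Lemma left_in_itv : a \in `[a, b].
Proof. by rewrite in_itv/= lexx ltW. Qed.

Lemma bd_norm k M g x : bd k M g -> x \in `[a, b] -> `|g x| <= M.
Proof. by case: k => [[_ gM]|k [gM _]]; exact: gM. Qed.

Lemma bd_ge0 k M g : bd k M g -> 0 <= M.
Proof. by move=> /bd_norm /(_ left_in_itv); exact: le_trans. Qed.

Lemma bd_le k M N g : M <= N -> bd k M g -> bd k N g.
Proof.
move=> MN; elim: k g => [|k IH] g /=; first exact: bmeas_le.
move=> [gM [h /IH hN gh]]; split; last by exists h.
by move=> x /gM /le_trans; apply.
Qed.

Lemma bd_eq k M g h : {in `[a, b], g =1 h} -> bd k M g -> bd k M h.
Proof.
case: k => [|k] gh /=; first exact: bmeas_eq.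
move=> [gM [d dM gd]]; split; first by move=> x xab; rewrite -gh ?gM.
by exists d => // x xab; rewrite -!gh ?left_in_itv// gd.
Qed.

Lemma eq_within_continuous g h : {in `[a, b], g =1 h} ->
  {within `[a, b], continuous g} -> {within `[a, b], continuous h}.
Proof. by move=> gh; apply: subspace_eq_continuous => x /set_mem/= /gh. Qed.

Lemma lipschitz_within_continuous K g :
  (forall x y, x \in `[a, b] -> y \in `[a, b] -> `|g x - g y| <= K * `|x - y|) ->
  {within `[a, b], continuous g}.
Proof.
move=> gK; have aab := left_in_itv; have bab := @clamp_itv _ a b _ (ltW ab).
have K0 : 0 <= K.
  rewrite -(@pmulr_lge0 _ `|b - a|) ?normr_gt0 ?subr_eq0 ?gt_eqF//.
  by apply: le_trans (gK b a _ aab); rewrite // in_itv/= lexx ltW.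
have cc : continuous (g \o clamp a b).
  apply: (@lipschitz_continuous _ K) => x y /=.
  rewrite (le_trans (gK _ _ (bab x) (bab y)))//.
  by rewrite ler_wpM2l ?clamp_lip.
apply: eq_within_continuous (continuous_subspaceT cc) => x xab.
by rewrite /= clamp_id.
Qed.

Lemma within_continuous_measurable g : {within `[a, b], continuous g} ->
  measurable_fun `[a, b] g.
Proof. by move=> cg; exact: subspace_continuous_measurable_fun. Qed.

Lemma primD_lip M h g : bmeas a b M h ->
  (forall x, x \in `[a, b] -> g x = g a + prim a h x) ->
  forall x y, x \in `[a, b] -> y \in `[a, b] -> `|g x - g y| <= M * `|x - y|.
Proof.
move=> hM gh x y xab yab; rewrite (gh x)// (gh y)//.
rewrite opprD addrACA subrr add0r; exact: (prim_lip hM xab yab).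
Qed.

Lemma bd_bmeas k M g : bd k M g -> bmeas a b M g.
Proof.
elim: k g => [//|k IH] g /= [gM [h /IH hM gh]]; split => //.
by apply: within_continuous_measurable; apply: lipschitz_within_continuous (primD_lip hM gh).
Qed.

Lemma bdS_lip k M g x y : bd k.+1 M g -> x \in `[a, b] -> y \in `[a, b] ->
  `|g x - g y| <= M * `|x - y|.
Proof. by move=> [_ [h /bd_bmeas hM gh]]; exact: primD_lip hM gh x y. Qed.

Lemma bdS_continuous k M g : bd k.+1 M g -> {within `[a, b], continuous g}.
Proof. by move=> gM; apply: (@lipschitz_within_continuous M) => x y; exact: bdS_lip gM. Qed.

Lemma bd_pred k M g : bd k.+1 M g -> bd k M g.
Proof.
elim: k g => [|k IH] g; first exact: bd_bmeas.
by move=> [gM [h /IH hM gh]]; split=> //; exists h.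
Qed.

Lemma bd0 k : bd k 0 (fun=> 0).
Proof.
elim: k => [|k IH] /=; first by have := bmeas_cst a b (0 : R); rewrite normr0.
split=> [x _|]; first by rewrite normr0.
by exists (fun=> 0) => // x xab; rewrite /prim Rintegral_cst// mul0r addr0.
Qed.

Lemma bdD k M N g h : bd k M g -> bd k N h -> bd k (M + N) (fun x => g x + h x).
Proof.
elim: k g h => [|k IH] g h /=; first exact: bmeasD.
move=> [gM [g' g'M gg']] [hN [h' h'N hh']]; split.
  by move=> x xab; rewrite (le_trans (ler_normD _ _))// lerD ?gM ?hN.
exists (fun x => g' x + h' x); first exact: IH.
move=> x xab; rewrite gg'// hh'// (primD xab (bd_bmeas g'M) (bd_bmeas h'N)).
by rewrite addrACA.
Qed.

(* Product rule: the product is Lipschitz, hence the primitive of its almost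
   everywhere derivative. *)
Lemma prim_prod M N g h u v :
  bmeas a b M g -> (forall x, x \in `[a, b] -> u x = u a + prim a g x) ->
  bmeas a b N h -> (forall x, x \in `[a, b] -> v x = v a + prim a h x) ->
  forall x, x \in `[a, b] ->
  u x * v x = u a * v a + prim a (fun t => g t * v t + u t * h t) x.
Proof.
move=> gM ug hN vh x xab.
have aab := left_in_itv.
have lu := primD_lip gM ug; have lv := primD_lip hN vh.
have cu := lipschitz_within_continuous lu; have cv := lipschitz_within_continuous lv.
have [U [mu_ uU]] := continuous_bmeas cu; have [V [mv vV]] := continuous_bmeas cv.
have M0 := bmeas_ge0 (ltW ab) gM; have N0 := bmeas_ge0 (ltW ab) hN.
have [w wK uvw] : exists2 w, bmeas a b (U * N + V * M) w &
    forall x, x \in `[a, b] -> u x * v x = u a * v a + prim a w x.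
  apply: (lipschitz_prim ab (g := fun x => u x * v x)) => s t sab tab.
  have -> : u s * v s - u t * v t = u s * (v s - v t) + v t * (u s - u t) by ring.
  rewrite (le_trans (ler_normD _ _))// mulrDl !normrM -!mulrA.
  by apply: lerD; apply: ler_pM => //; [exact: uU|exact: lv|exact: vV|exact: lu].
rewrite uvw//; congr (_ + _); have [mw _] := wK.
have mr : measurable_fun `[a, b] (fun t => g t * v t + u t * h t).
  have [mg _] := gM; have [mh _] := hN.
  by apply: measurable_funD; apply: measurable_funM.
apply: (ae_eq_prim xab mw mr).
apply: (aeS3 _ (prim_derivable_ae (bmeas_integrable wK))
  (prim_derivable_ae (bmeas_integrable gM)) (prim_derivable_ae (bmeas_integrable hN))).
move=> t Hw Hg Hh tab; have [w1 w2] := Hw tab; have [g1 g2] := Hg tab.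
have [h1 h2] := Hh tab.
have E : {in `]a, b[, prim a w =1 fun x => - (u a * v a) +
    (u a + prim a g x) * (v a + prim a h x)}.
  by move=> s /subset_itv_oo_cc sab; rewrite -(ug s)// -(vh s)// (uvw s)// addKr.
have D : is_derive t 1 (fun x => (u a + prim a g x) * (v a + prim a h x))
    ((u a + prim a g t) * h t + (v a + prim a h t) * g t).
  exact: is_deriveM (is_derive_addl _ g1 g2) (is_derive_addl _ h1 h2).
have [D1 D2] := D; rewrite -derive1E in D2.
have [_ D3] := is_derive_addl (- (u a * v a)) D1 D2; rewrite -derive1E in D3.
have tab' := subset_itv_oo_cc tab.
by rewrite -w2 (derive1_itv_oo tab E) D3 -(ug t)// -(vh t)//; ring.
Qed.

(** Each order doubles the constant, because the derivative of a product is a sum of two products of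
    one order less. *)
Lemma bdM k M N g h : bd k M g -> bd k N h ->
  bd k (2 ^+ k * (M * N)) (fun x => g x * h x).
Proof.
elim: k g h => [|k IH] g h; first by rewrite expr0 mul1r; exact: bmeasM.
move=> bg bh; have M0 := bd_ge0 bg; have N0 := bd_ge0 bh.
have MN0 := mulr_ge0 M0 N0.
have [gM [g' g'M gg']] := bg; have [hN [h' h'N hh']] := bh; split.
  move=> x xab; apply: (@le_trans _ _ (M * N)).
    by rewrite normrM ler_pM ?gM ?hN.
  by rewrite ler_peMl// exprn_ege1// ler1n.
exists (fun x => g' x * h x + g x * h' x).
  rewrite exprS -mulrA mulr_natl mulr2n.
  by apply: bdD; apply: IH => //; exact: bd_pred.
by move=> x; exact: (prim_prod (bd_bmeas g'M) gg' (bd_bmeas h'N) hh').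
Qed.

Lemma bdZ k M c g : bd k M g -> bd k (`|c| * M) (fun x => c * g x).
Proof.
elim: k g => [|k IH] g /=; first by move=> gM; exact: bmeasM (bmeas_cst _ _ c) gM.
move=> [gM [h hM gh]]; split; first by move=> x xab; rewrite normrM ler_wpM2l ?gM.
exists (fun x => c * h x); first exact: IH.
by move=> x xab; rewrite gh// (primZ _ xab (bd_bmeas hM)) mulrDr.
Qed.

Lemma bdN k M g : bd k M g -> bd k M (fun x => - g x).
Proof.
by move=> /(bdZ (-1)); rewrite normrN normr1 mul1r; apply: bd_eq => x _; rewrite mulN1r.
Qed.

Lemma bdB k M N g h : bd k M g -> bd k N h -> bd k (M + N) (fun x => g x - h x).
Proof. by move=> gM /bdN hN; exact: bdD. Qed.

Lemma bd_sum k (I : Type) (r : seq I) (M : I -> R) (g : I -> R -> R) :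
  (forall i, bd k (M i) (g i)) ->
  bd k (\sum_(i <- r) M i) (fun x => \sum_(i <- r) g i x).
Proof.
move=> gM; elim: r => [|i r IH].
  by rewrite big_nil; apply: bd_eq (bd0 k) => x _; rewrite big_nil.
rewrite big_cons; apply: bd_eq (bdD (gM i) IH) => x _.
by rewrite big_cons.
Qed.

Lemma bd_sum_nat k m n (M : nat -> R) (g : nat -> R -> R) :
  (forall i, bd k (M i) (g i)) ->
  bd k (\sum_(m <= i < n) M i) (fun x => \sum_(m <= i < n) g i x).
Proof. exact: bd_sum. Qed.

End BoundedDerivatives.

(** * Geometric series and completeness *)

Section GeometricSeries.
Context {R : realType}.
Implicit Types (C z : R).

Definition geo (n : nat) : R := (4^-1) ^+ n.

Lemma geo_gt0 n : 0 < geo n.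
Proof. by rewrite exprn_gt0// invr_gt0. Qed.

Lemma geoS n : geo n.+1 = geo n / 4.
Proof. by rewrite /geo exprS mulrC. Qed.

(** The induction runs on the sharp form, with the factor [4 / 3] and the subtracted term [geo n]; 2
    is a rounder constant. *)
Lemma geo_sum C N n : 0 <= C -> \sum_(N <= i < n) C * geo i <= 2 * C * geo N.
Proof.
move=> C0; have [nN|/ltnW Nn] := leqP n N.
  by rewrite big_geq// !mulr_ge0// ltW// geo_gt0.
suff : \sum_(N <= i < n) C * geo i <= 4 / 3 * C * (geo N - geo n).
  have := mulr_ge0 C0 (ltW (geo_gt0 N)); have := mulr_ge0 C0 (ltW (geo_gt0 n)).
  nra.
rewrite -(subnKC Nn); elim: (n - N)%N => [|d IH].
  by rewrite addn0 big_geq// subrr mulr0.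
rewrite addnS big_nat_recr ?leq_addr//= geoS.
have := mulr_ge0 C0 (ltW (geo_gt0 (N + d))); move: IH.
set s := \sum_(_ <= _ < _) _; nra.
Qed.

(** Identities between limits are proved with this: the norm of the difference is bounded by a fixed
    multiple of every [geo n]. *)
Lemma geo_le0 C z : (forall n, z <= C * geo n) -> z <= 0.
Proof.
move=> zC; have c0 : C * geo n @[n --> \oo] --> C * 0.
  apply: cvgMr; apply: cvg_expr; rewrite ger0_norm ?invr_ge0//.
  by rewrite invf_lt1// ltr1n.
rewrite -(mulr0 C) -(cvg_lim _ c0)//.
by apply: limr_ge; [exact: cvgP c0|exact: nearW].
Qed.

Lemma geo_series C (u : nat -> R) : (forall i, `|u i| <= C * geo i) ->
  cvg (\sum_(0 <= i < n) u i @[n --> \oo]) /\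
  forall N, `|lim (\sum_(0 <= i < n) u i @[n --> \oo]) - \sum_(0 <= i < N) u i|
    <= 2 * C * geo N.
Proof.
move=> uC; have C0 : 0 <= C.
  by have := le_trans (normr_ge0 _) (uC 0%N); rewrite /geo expr0 mulr1.
have cu : cvg (\sum_(0 <= i < n) u i @[n --> \oo]).
  apply: (@normed_cvg _ _ u); apply: nondecreasing_is_cvgn.
    by apply: (@nondecreasing_series _ (fun n => `|u n|) xpredT 0%N).
  exists (2 * C * geo 0) => _ [n _ <-]; rewrite /series/=.
  by apply: le_trans (geo_sum 0 n C0); exact: ler_sum.
split=> // N.
have cN : `|\sum_(0 <= i < n) u i - \sum_(0 <= i < N) u i| @[n --> \oo] -->
    `|lim (\sum_(0 <= i < n) u i @[n --> \oo]) - \sum_(0 <= i < N) u i|.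
  by apply: cvg_norm; apply: cvgB => //; exact: cvg_cst.
rewrite -(cvg_lim _ cN)//; apply: limr_le; first exact: cvgP cN.
near=> n; have Nn : (N <= n)%N by near: n; exact: nbhs_infty_ge.
rewrite (@big_cat_nat _ _ _ N)//= addrAC subrr add0r.
apply: le_trans (geo_sum N n C0); rewrite (le_trans (ler_norm_sum _ _ _))//.
exact: ler_sum.
Unshelve. all: by end_near. Qed.

End GeometricSeries.

Section Completeness.
Context {R : realType} (a b : R).
Hypothesis ab : a < b.
Notation mu := (@lebesgue_measure R).
Implicit Types (g h u v : R -> R) (x y K M C : R) (k N : nat).

Definition series_fun (g : nat -> R -> R) x := lim (\sum_(0 <= i < n) g i x @[n --> \oo]).

(** Completeness of the space of order [k], with a rate. The derivatives [h i] of the terms satisfy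
    the same geometric bounds, so the induction hypothesis applies to them, and their sum turns out
    to be the derivative of the sum. *)
Lemma bd_geo_series k C (g : nat -> R -> R) : (forall i, bd a b k (C * geo i) (g i)) ->
  forall n, bd a b k (2 * C * geo n)
    (fun x => series_fun g x - \sum_(0 <= i < n) g i x).
Proof.
elim: k g => [|k IH] g gC n.
  split.
    apply: measurable_funB; last by apply: measurable_sum => i; have [] := gC i.
    apply: (@measurable_fun_cvg _ _ _ _ (fun n x => \sum_(0 <= i < n) g i x)).
      by move=> m; apply: measurable_sum => i; have [] := gC i.
    move=> x xab; have [|+ _] := @geo_series _ C (g ^~ x); last by [].
    by move=> i; have [_] := gC i; apply.
  move=> x xab; have [|_] := @geo_series _ C (g ^~ x); last by apply.
  by move=> i; have [_] := gC i; apply.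
have /choice[h hP] : forall i, exists h, bd a b k (C * geo i) h /\
    forall x, x \in `[a, b] -> g i x = g i a + prim a h x.
  by move=> i; have [_ [h ? ?]] := gC i; exists h.
have hC i := (hP i).1; have aab := left_in_itv ab.
have gx x : x \in `[a, b] -> forall N,
    `|series_fun g x - \sum_(0 <= i < N) g i x| <= 2 * C * geo N.
  move=> xab; have [|_] := @geo_series _ C (g ^~ x); last by apply.
  by move=> i; exact: (bd_norm (gC i)).
have sum_prim N x : x \in `[a, b] -> \sum_(0 <= i < N) g i x =
    \sum_(0 <= i < N) g i a + prim a (fun t => \sum_(0 <= i < N) h i t) x.
  move=> xab; elim: N => [|N IHN].
    rewrite !big_geq// add0r (@eq_prim _ _ b _ (fun=> 0))//.
      by rewrite /prim Rintegral_cst// mul0r.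
    by move=> t _; rewrite big_geq.
  have bsum := bd_bmeas ab (bd_sum_nat ab 0 N hC).
  have -> : prim a (fun t => \sum_(0 <= i < N.+1) h i t) x =
      prim a (fun t => \sum_(0 <= i < N) h i t) x + prim a (h N) x.
    rewrite -(primD xab bsum (bd_bmeas ab (hC N))).
    by apply: (eq_prim xab) => t _; rewrite big_nat_recr.
  by rewrite !big_nat_recr//= IHN (hP N).2// addrACA.
have dprim N x : x \in `[a, b] ->
    prim a (fun t => series_fun h t - \sum_(0 <= i < N) h i t) x =
    prim a (series_fun h) x - prim a (fun t => \sum_(0 <= i < N) h i t) x.
  move=> xab.
  have bsum := bd_bmeas ab (bd_sum_nat ab 0 N hC).
  have b2 : bmeas a b (2 * C * geo 0) (series_fun h).
    by apply: bmeas_eq (bd_bmeas ab (IH _ hC 0%N)) => t _; rewrite big_geq// subr0.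
  have b3 := bmeasM (bmeas_cst _ _ (-1)) bsum.
  rewrite -mulN1r -(primZ _ xab bsum) -(primD xab b2 b3).
  by apply: (eq_prim xab) => t _; rewrite mulN1r.
have Gx x : x \in `[a, b] -> series_fun g x = series_fun g a + prim a (series_fun h) x.
  move=> xab; apply/eqP; rewrite -subr_eq0 -normr_le0.
  (* The three terms bound the tail at [x], the tail at [a], and the primitive of the tail of the
     derivatives. *)
  apply: (@geo_le0 _ (2 * C + 2 * C + 2 * C * (b - a))) => N.
  have -> : series_fun g x - (series_fun g a + prim a (series_fun h) x) =
     (series_fun g x - \sum_(0 <= i < N) g i x) -
     (series_fun g a - \sum_(0 <= i < N) g i a) -
     prim a (fun t => series_fun h t - \sum_(0 <= i < N) h i t) x.
    by rewrite dprim// (sum_prim N x)//; ring.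
  have := prim_lip (bd_bmeas ab (IH _ hC N)) xab aab; rewrite prim_a subr0 => px.
  set D := 2 * C; rewrite (mulrDl (D + D)) (mulrDl D).
  apply: le_trans (ler_normB _ _) _; apply: lerD.
    by apply: le_trans (ler_normB _ _) _; apply: lerD; apply: gx.
  apply: (le_trans px); rewrite -/D (mulrAC D (b - a)).
  rewrite ler_wpM2l//; first exact: bd_ge0 (IH _ hC N).
  move: xab; rewrite in_itv/= => /andP[ax xb].
  by rewrite ger0_norm ?subr_ge0// lerB.
split; first by move=> x xab; exact: gx.
exists (fun x => series_fun h x - \sum_(0 <= i < n) h i x); first exact: IH.
by move=> x xab; rewrite dprim// Gx// sum_prim//; ring.
Qed.

End Completeness.

(** * Real linear systems *)

Section LinearSystem.
Context {R : realType} (a b : R) (I : finType).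
Hypothesis ab : a < b.
Notation mu := (@lebesgue_measure R).
Implicit Types (x y K M N C Q S : R) (k n : nat).
Implicit Types (A : I -> I -> R -> R) (F u v : I -> R -> R) (q : I -> R).

Definition rhs A F u i t := F i t - \sum_j A i j t * u j t.

Definition integral_eq A F u :=
  forall i x, x \in `[a, b] -> u i x = u i a + prim a (rhs A F u i) x.

Lemma rhs_bd k M N C A F u : (forall i j, bd a b k M (A i j)) ->
  (forall i, bd a b k N (F i)) -> (forall i, bd a b k C (u i)) ->
  forall i, bd a b k (N + #|I|%:R * (2 ^+ k * (M * C))) (rhs A F u i).
Proof.
move=> AM FN uC i; apply: bdB => //.
have -> : #|I|%:R * (2 ^+ k * (M * C)) = \sum_(j : I) 2 ^+ k * (M * C).
  by rewrite sumr_const mulr_natl.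
by apply: bd_sum => // j; exact: bdM.
Qed.

(** Integrating [weight M] from [a] divides it by at least [growth M]. The factor 4 thus makes the
    integral operator with coefficients bounded by [M] a contraction of ratio 1/4 for the supremum
    of [|u| / weight M]; the [+ 1] keeps the rate positive when [#|I|%:R * M] is zero. *)
Definition growth M := 4 * (#|I|%:R * M) + 1.
Definition weight M x := expR (growth M * (x - a)).

Lemma growth_gt0 M : 0 <= M -> 0 < growth M.
Proof. by move=> M0; rewrite ltr_wpDl// mulr_ge0// mulr_ge0. Qed.

Lemma weight_ge1 M x : 0 <= M -> x \in `[a, b] -> 1 <= weight M x.
Proof.
rewrite in_itv/= => M0 /andP[ax _]; rewrite -expR0 ler_expR.
by rewrite mulr_ge0 ?subr_ge0// ltW// growth_gt0.
Qed.

Lemma weight_le M x : 0 <= M -> x \in `[a, b] -> weight M x <= weight M b.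
Proof.
rewrite in_itv/= => M0 /andP[_ xb]; rewrite ler_expR ler_wpM2l ?lerD2r//.
exact/ltW/growth_gt0.
Qed.

Lemma weight_bmeas M : 0 <= M -> bmeas a b (weight M b) (weight M).
Proof.
move=> M0; split.
  apply: within_continuous_measurable; apply: derivable_within_continuous => x _.
  by apply: ex_derive.
move=> x xab; rewrite ger0_norm ?weight_le//.
exact: le_trans ler01 (weight_ge1 M0 xab).
Qed.

Lemma prim_weight M x : 0 <= M -> x \in `[a, b] ->
  #|I|%:R * M * prim a (weight M) x <= weight M x / 4.
Proof.
move=> M0 xab; have g0 := growth_gt0 M0.
have D (t : R) : is_derive t 1 (weight M) (growth M * weight M t).
  by apply: is_derive_eq; rewrite /GRing.scale/= /weight; ring.
have cw : {within `[a, b], continuous (weight M)}.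
  by apply: derivable_within_continuous => t _; apply: ex_derive.
have cgw : {within `[a, b], continuous (fun t => growth M * weight M t)}.
  apply: derivable_within_continuous => t _.
  by apply: derivableM => //; apply: ex_derive.
have := @prim_FTC _ a b (weight M) (fun t => growth M * weight M t) x cw cgw.
move=> /(_ _ xab); rewrite (primZ _ xab (weight_bmeas M0)) => -> //; last first.
  by move=> t _; split; [exact: ex_derive|rewrite derive1E derive_val].
have wa : 0 <= weight M a by exact: expR_ge0.
have p0 : 0 <= prim a (weight M) x.
  by apply: Rintegral_ge0 => t _; exact: expR_ge0.
rewrite /growth in g0 *; nra.
Qed.

(** The contraction property in the weighted norm. It drives both the growth bound and the
    convergence of the iteration. *)
Lemma normr_prim_sum M C S A v i x : (forall i j, bmeas a b M (A i j)) ->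
  (forall i, bmeas a b S (v i)) ->
  (forall i t, t \in `[a, b] -> `|v i t| <= C * weight M t) -> x \in `[a, b] ->
  `|prim a (fun t => \sum_j A i j t * v j t) x| <= C / 4 * weight M x.
Proof.
move=> AM vS vC xab; have M0 := bmeas_ge0 (ltW ab) (AM i i).
have C0 : 0 <= C.
  have := le_trans (normr_ge0 _) (vC i x xab); rewrite pmulr_lge0//; exact: expR_gt0.
have b1 : bd a b 0 (\sum_(j : I) M * S) (fun t => \sum_j A i j t * v j t).
  by apply: bd_sum => // j; exact: bmeasM.
have b2 := bmeasM (bmeas_cst a b (#|I|%:R * M * C)) (weight_bmeas M0).
apply: (le_trans (normr_prim_le xab b1 b2 _)).
  move=> t tab; apply: (le_trans (ler_norm_sum _ _ _)).
  have -> : #|I|%:R * M * C * weight M t = \sum_(j : I) M * (C * weight M t).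
    by rewrite sumr_const -mulr_natl; ring.
  apply: ler_sum => j _; rewrite normrM ler_pM ?vC//.
  by have [_] := AM i j; apply.
rewrite (primZ _ xab (weight_bmeas M0)).
have := prim_weight M0 xab; set p := prim _ _ _ => H.
have -> : #|I|%:R * M * C * p = C * (#|I|%:R * M * p) by ring.
have -> : C / 4 * weight M x = C * (weight M x / 4) by field.
exact: ler_wpM2l.
Qed.


(** A Gronwall bound obtained by iteration: each use of the integral equation divides the excess
    [S * geo n] over [2 * P] by 4, so the unspecified bound [S] disappears in the limit. *)
Lemma integral_eq_growth M N Q S A F u :
  (forall i j, bmeas a b M (A i j)) -> (forall i, bmeas a b N (F i)) ->
  (forall i, bmeas a b S (u i)) -> (forall i, `|u i a| <= Q) ->
  integral_eq A F u ->
  forall i x, x \in `[a, b] -> `|u i x| <= 2 * (Q + N * (b - a)) * weight M b.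
Proof.
move=> AM FN uS uQ ueq i0 x0 x0ab.
have M0 := bmeas_ge0 (ltW ab) (AM i0 i0); have N0 := bmeas_ge0 (ltW ab) (FN i0).
have S0 := bmeas_ge0 (ltW ab) (uS i0); have Q0 := le_trans (normr_ge0 _) (uQ i0).
have ba0 : 0 < b - a by rewrite subr_gt0.
set P := Q + N * (b - a); have P0 : 0 <= P by rewrite addr_ge0// mulr_ge0// ltW.
have aab := left_in_itv ab.
suff H n : forall i x, x \in `[a, b] -> `|u i x| <= (2 * P + S * geo n) * weight M x.
  apply: (@le_trans _ _ (2 * P * weight M x0)); last first.
    by rewrite ler_wpM2l ?mulr_ge0 ?weight_le.
  rewrite -subr_le0; apply: (@geo_le0 _ (S * weight M x0)) => n.
  by have := H n i0 x0 x0ab; lra.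
elim: n => [|n IH] i x xab.
  rewrite /geo expr0 mulr1; have [_ /(_ x xab) uSx] := uS i.
  have := weight_ge1 M0 xab; nra.
have bA : bmeas a b (\sum_(j : I) M * S) (fun t => \sum_j A i j t * u j t).
  have : bd a b 0 (\sum_(j : I) M * S) (fun t => \sum_j A i j t * u j t).
    by apply: bd_sum => // j; exact: bmeasM.
  by [].
have bA' := bmeasM (bmeas_cst _ _ (-1)) bA.
have -> : u i x = u i a + prim a (F i) x -
    prim a (fun t => \sum_j A i j t * u j t) x.
  rewrite (ueq i x xab) -addrA -[- prim _ _ x]mulN1r -(primZ _ xab bA) -(primD xab (FN i) bA').
  by congr (_ + _); apply: (eq_prim xab) => t _; rewrite /rhs mulN1r.
have pF : `|prim a (F i) x| <= N * (b - a).
  have := prim_lip (FN i) xab aab; rewrite prim_a subr0 => /le_trans; apply.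
  move: xab; rewrite in_itv/= => /andP[ax xb].
  by rewrite ler_wpM2l// ger0_norm ?subr_ge0// lerB.
have pA := normr_prim_sum i AM uS IH xab.
have uQi := uQ i; have w1 := weight_ge1 M0 xab.
apply: (le_trans (ler_normB _ _)); apply: (le_trans (lerD (ler_normD _ _) pA)).
apply: (@le_trans _ _ (P + (2 * P + S * geo n) / 4 * weight M x)).
  by rewrite lerD2r lerD.
rewrite geoS; have Pw : P <= P * weight M x by rewrite ler_peMr.
have PW : 0 <= P * weight M x := le_trans P0 Pw.
move: Pw PW; set w := weight M x; set g := geo n => Pw PW.
have -> : (2 * P + S * g) / 4 * w = (P * w) / 2 + S * (g / 4) * w by field.
rewrite [leRHS]mulrDl; lra.
Qed.

(** [K] is chosen before [A], [F] and [u], and [S] does not enter the conclusion. Order zero is the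
    growth bound; each further order is read off the equation, since the derivative of [u] is
    [rhs A F u]. *)
Lemma integral_eq_apriori k M : exists2 K, 0 <= K & forall A F u N Q S,
  (forall i j, bd a b k M (A i j)) -> (forall i, bd a b k N (F i)) ->
  (forall i, bmeas a b S (u i)) -> (forall i, `|u i a| <= Q) ->
  integral_eq A F u -> forall i, bd a b k.+1 (K * (N + Q)) (u i).
Proof.
have ba0 : 0 < b - a by rewrite subr_gt0.
pose K0 := 2 * (1 + (b - a)) * weight M b.
have w0 : 0 < weight M b by exact: expR_gt0.
have K00 : 0 <= K0 by rewrite !mulr_ge0// ?ltW//; lra.
have base A F u N Q S : (forall i j, bmeas a b M (A i j)) ->
    (forall i, bmeas a b N (F i)) -> (forall i, bmeas a b S (u i)) ->
    (forall i, `|u i a| <= Q) -> integral_eq A F u ->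
    forall i, bmeas a b (K0 * (N + Q)) (u i).
  move=> AM FN uS uQ ueq i; split; first by have [] := uS i.
  move=> x xab; apply: le_trans (integral_eq_growth AM FN uS uQ ueq i xab) _.
  have N0 := bmeas_ge0 (ltW ab) (FN i).
  have Q0 := le_trans (normr_ge0 _) (uQ i).
  rewrite /K0 (mulrAC _ (weight M b)) ler_pM2r// -[leRHS]mulrA ler_pM2l//.
  by have := mulr_ge0 (ltW ba0) Q0; lra.
have step j K A F u N Q : 0 <= M ->
    (forall i j', bd a b j M (A i j')) -> (forall i, bd a b j N (F i)) ->
    0 <= Q -> integral_eq A F u -> 0 <= K ->
    (forall i, bd a b j (K * (N + Q)) (u i)) ->
    forall i, bd a b j.+1 ((K + 1 + #|I|%:R * (2 ^+ j * (M * K))) * (N + Q)) (u i).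
  move=> M0 AM FN Q0 ueq KK uK i; have N0 := bd_ge0 ab (FN i).
  have NQ0 : 0 <= N + Q by exact: addr_ge0.
  have c0 : 0 <= #|I|%:R * (2 ^+ j * (M * K)) by rewrite !mulr_ge0// exprn_ge0.
  split.
    move=> x xab; apply: le_trans (bd_norm (uK i) xab) _.
    by rewrite ler_wpM2r//; lra.
  exists (rhs A F u i); last exact: ueq.
  apply: bd_le (rhs_bd AM FN uK i).
  have := mulr_ge0 KK NQ0; rewrite !mulrDl mul1r; lra.
have cst0 j K : 0 <= M -> 0 <= K -> 0 <= K + 1 + #|I|%:R * (2 ^+ j * (M * K)).
  by move=> M0 KK; rewrite !addr_ge0// !mulr_ge0// exprn_ge0.
(* A negative [M] cannot bound the coefficient [A i i]. *)
have [M0|M0] := leP 0 M; last first.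
  exists 0 => // A F u N Q S AM _ _ _ _ i.
  by have := bd_ge0 ab (AM i i); rewrite leNgt M0.
elim: k => [|k [K KK IH]].
  exists (K0 + 1 + #|I|%:R * (2 ^+ 0 * (M * K0))); first exact: cst0.
  move=> A F u N Q S AM FN uS uQ ueq i; apply: (step _ _ _ _ _ _ _ _ AM) => //.
  - exact: le_trans (normr_ge0 _) (uQ i).
  - exact: base uS uQ ueq.
exists (K + 1 + #|I|%:R * (2 ^+ k.+1 * (M * K))); first exact: cst0.
move=> A F u N Q S AM FN uS uQ ueq i; apply: (step _ _ _ _ _ _ _ _ AM) => //.
  exact: le_trans (normr_ge0 _) (uQ i).
by apply: IH uS uQ ueq => *; exact: bd_pred.
Qed.

End LinearSystem.

(** * Solution of the integral equation by iteration *)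

Section Picard.
Context {R : realType} (a b : R) (I : finType).
Hypothesis ab : a < b.
Implicit Types (x y K M N C Q S : R) (k n : nat) (h : R -> R).
Implicit Types (A : I -> I -> R -> R) (F u v : I -> R -> R) (q : I -> R).

Lemma normr_prim_bound C h x : bmeas a b C h -> x \in `[a, b] ->
  `|prim a h x| <= C * (b - a).
Proof.
move=> hC xab; have := prim_lip hC xab (left_in_itv ab).
rewrite prim_a subr0 => /le_trans; apply.
have C0 := bmeas_ge0 (ltW ab) hC.
move: xab; rewrite in_itv/= => /andP[ax xb].
by rewrite ler_wpM2l// ger0_norm ?subr_ge0// lerB.
Qed.

Lemma prim_bmeas C h (c : R) : bmeas a b C h ->
  bmeas a b (`|c| + C * (b - a)) (fun x => c + prim a h x).
Proof.
move=> hC; split; last first.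
  by move=> x xab; rewrite (le_trans (ler_normD _ _))// lerD2l normr_prim_bound.
apply: measurable_funD => //; apply: within_continuous_measurable.
by apply: (lipschitz_within_continuous ab (K := C)) => x y; exact: prim_lip.
Qed.

Lemma prim_rhsB M N S T A F u v i x : (forall i j, bmeas a b M (A i j)) ->
  (forall i, bmeas a b N (F i)) ->
  (forall i, bmeas a b S (u i)) -> (forall i, bmeas a b T (v i)) ->
  x \in `[a, b] ->
  prim a (rhs A F u i) x - prim a (rhs A F v i) x =
  - prim a (fun t => \sum_j A i j t * (u j t - v j t)) x.
Proof.
move=> AM FN uS vT xab.
have bu := @rhs_bd _ _ _ _ ab 0 _ _ _ _ _ _ AM FN uS i.
have bv := @rhs_bd _ _ _ _ ab 0 _ _ _ _ _ _ AM FN vT i.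
have bv' := bmeasM (bmeas_cst _ _ (-1)) bv.
have buv := bmeasD bu bv'.
rewrite -[- prim _ (rhs _ _ _ _) _]mulN1r -(primZ _ xab bv) -(primD xab bu bv').
rewrite -[RHS]mulN1r.
rewrite [X in _ = -1 * X](@eq_prim _ _ b _ (fun t => -1 * (rhs A F u i t + -1 * rhs A F v i t)))//.
  by rewrite (primZ _ xab buv); ring.
move=> t _; rewrite /rhs; under eq_bigr do rewrite mulrBr.
by rewrite sumrB; ring.
Qed.

Lemma integral_eq_exists M N A F q : (forall i j, bmeas a b M (A i j)) ->
  (forall i, bmeas a b N (F i)) ->
  exists u, [/\ forall i, u i a = q i, integral_eq a b A F u &
    exists S, forall i, bmeas a b S (u i)].
Proof.
move=> AM FN.
have [i0|I0] := pickP (@predT I); last first.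
  by exists (fun i _ => q i); split=> [//|i|]; [have := I0 i|exists 0 => i; have := I0 i].
move=> _; have M0 := bmeas_ge0 (ltW ab) (AM i0 i0); have N0 := bmeas_ge0 (ltW ab) (FN i0).
have ba0 : 0 < b - a by rewrite subr_gt0.
have aab := left_in_itv ab.
pose Q := \sum_i `|q i|; have Q0 : 0 <= Q by exact: sumr_ge0.
have qQ i : `|q i| <= Q by rewrite /Q (bigD1 i)//= lerDl sumr_ge0.
pose p := fix p n := if n is n'.+1 then fun i x => q i + prim a (rhs A F (p n') i) x
  else fun (_ : I) (_ : R) => 0 : R.
have pS n i x : p n.+1 i x = q i + prim a (rhs A F (p n) i) x by [].
have pb n : exists S, forall i, bmeas a b S (p n i).
  elim: n => [|n [S IH]]; first by exists 0 => i; exact: (bd0 a b 0).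
  exists (Q + (N + #|I|%:R * (2 ^+ 0 * (M * S))) * (b - a)) => i; apply: bmeas_le (prim_bmeas (q i)
    (@rhs_bd _ _ _ _ ab 0 _ _ _ _ _ _ AM FN IH i)).
  by rewrite lerD2r; exact: qQ.
(* The iteration starts at zero, so the first increment is [q] plus the primitive of [F]; [C] bounds
   it. *)
pose C := Q + N * (b - a); have C0 : 0 <= C by rewrite addr_ge0// mulr_ge0// ltW.
pose W := weight a I M b.
have W1 : 1 <= W by apply: (@weight_ge1 _ _ b) => //; rewrite in_itv/= lexx ltW.
have CW0 : 0 <= C * W by rewrite mulr_ge0// (le_trans ler01).
pose d n i x := p n.+1 i x - p n i x.
have db n : exists S, forall i, bmeas a b S (d n i).
  have [S hS] := pb n; have [T hT] := pb n.+1.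
  by exists (T + S) => i; exact: (@bdB _ _ _ ab 0 _ _ _ _ (hT i) (hS i)).
have dC n : forall i x, x \in `[a, b] -> `|d n i x| <= C * geo n * weight a I M x.
  elim: n => [|n IH] i x xab.
    have := @rhs_bd _ _ _ _ ab 0 _ _ _ _ _ _ AM FN (fun=> bd0 a b 0) i.
    rewrite !mulr0 addr0 => /(prim_bmeas (q i)) [_ /(_ x xab) H].
    rewrite /d subr0 /geo expr0 mulr1; apply: (@le_trans _ _ C).
      by apply: le_trans H _; rewrite lerD2r.
    by rewrite ler_peMr// (weight_ge1 _ M0 xab).
  have [S hS] := pb n; have [T hT] := pb n.+1; have [D hD] := db n.
  have -> : d n.+1 i x = - prim a (fun t => \sum_j A i j t * d n j t) x.
    rewrite /d -(prim_rhsB i AM FN hT hS xab) (pS n.+1) (pS n) opprD addrACA.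
    by rewrite subrr add0r.
  rewrite normrN geoS mulrA.
  exact: (normr_prim_sum ab i AM hD IH xab).
have dW n i : bd a b 0 (C * W * geo n) (d n i).
  have [S hS] := db n; split; first by have [] := hS i.
  move=> x xab; apply: le_trans (dC n i x xab) _.
  rewrite mulrAC ler_wpM2r ?(ltW (geo_gt0 _))// ler_wpM2l//.
  exact: weight_le M0 xab.
pose u i := series_fun (fun n => d n i).
have sump n i x : \sum_(0 <= m < n) d m i x = p n i x.
  by rewrite (telescope_sumr (fun m => p m i x))// subr0.
have up n i : bmeas a b (2 * (C * W) * geo n) (fun x => u i x - p n i x).
  apply: bmeas_eq (bd_geo_series ab (fun m => dW m i) n) => x _.
  by rewrite sump.
have ub i : bmeas a b (2 * (C * W)) (u i).
  have := up 0%N i; rewrite /geo expr0 mulr1; apply: bmeas_eq => x _.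
  by rewrite subr0.
have ueq i x : x \in `[a, b] -> u i x = q i + prim a (rhs A F u i) x.
  move=> xab; apply/eqP; rewrite -subr_eq0 -normr_le0.
  pose D := 2 * (C * W).
  (* The defect of the limit is its distance to the iterate [n.+1] plus the integral operator
     applied to its distance to the iterate [n]. *)
  apply: (@geo_le0 _ (D + #|I|%:R * M * D * (b - a))) => n.
  have [S hS] := pb n.
  have -> : u i x - (q i + prim a (rhs A F u i) x) =
      (u i x - p n.+1 i x) - (prim a (rhs A F u i) x - prim a (rhs A F (p n) i) x).
    by rewrite pS; ring.
  rewrite (prim_rhsB i AM FN ub hS xab) opprK mulrDl.
  apply: le_trans (ler_normD _ _) _; apply: lerD.
    have [_ /(_ x xab) H] := up n.+1 i; apply: le_trans H _.
    by have := mulr_ge0 CW0 (ltW (geo_gt0 n)); rewrite geoS /D; lra.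
  have bs : bd a b 0 (\sum_(j : I) M * (D * geo n))
      (fun t => \sum_j A i j t * (u j t - p n j t)).
    by apply: bd_sum => // j; exact: bmeasM.
  apply: le_trans (normr_prim_bound bs xab) _.
  by rewrite sumr_const -mulr_natl; lra.
exists u; split.
- by move=> i; rewrite ueq// prim_a addr0.
- by move=> i x xab; rewrite ueq// (ueq i a)// prim_a addr0.
- by exists (2 * (C * W)).
Qed.

End Picard.

(** * Sobolev functions and their representatives *)

Section RealBridge.
Context {R : realType} (a b : R).
Hypothesis ab : a < b.
Notation mu := (@lebesgue_measure R).
Implicit Types (f g h u v : R -> R) (x y K M N : R) (k j : nat).

Lemma within_cvg u x : {within `[a, b], continuous u} -> x \in `[a, b] ->
  forall e, 0 < e -> exists2 d, 0 < d &
    forall t, t \in `[a, b] -> `|x - t| < d -> `|u x - u t| < e.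
Proof.
move=> /subspace_continuousP cu xab e e0.
have /cvgrPdist_lt/(_ _ e0) := cu x xab.
rewrite near_withinE => /nbhs_ballP[d d0 H]; exists d => // t tab xt.
exact: H.
Qed.

(** This turns essential bounds into pointwise ones: if the bound failed at a point, continuity
    would make it fail on an interval of positive length. *)
Lemma ae_le_everywhere u M : {within `[a, b], continuous u} ->
  {ae mu, forall x, x \in `]a, b[ -> u x <= M} ->
  forall x, x \in `[a, b] -> u x <= M.
Proof.
move=> cu aeM x xab; rewrite leNgt; apply/negP => Mx.
have [|d d0 H] := within_cvg cu xab (e := u x - M); first by rewrite subr_gt0.
move: (xab); rewrite in_itv/= => /andP[ax xb].
pose l := Num.max a (x - d); pose r := Num.min b (x + d).
have lr : l < r.
  by rewrite /l /r gt_max !lt_min ab/=; apply/and3P; split; lra.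
have [t] := ae_itv_dense lr aeM.
rewrite in_itv/= /l /r gt_max => /andP[/andP[at_ xdt]].
rewrite lt_min => /andP[tb txd].
rewrite in_itv/= at_ tb => /(_ isT) tM.
have : `|u x - u t| < u x - M.
  by apply: H; rewrite ?in_itv/= ?ltW// ltr_norml; apply/andP; split; lra.
by rewrite ltNge (le_trans _ (ler_norm _))// lerD2l lerN2.
Qed.

Lemma iter_derive1_oo u v j : {in `]a, b[, u =1 v} ->
  {in `]a, b[, iter j (@derive1 R R) u =1 iter j (@derive1 R R) v}.
Proof.
by move=> uv; elim: j => [//|j IH] x xab /=; exact: (derive1_itv_oo xab IH).
Qed.

(** The conditions that [W k.+1] imposes on one real part; the index is lower by one. *)
Definition RW k u :=
  [/\ {within `[a, b], continuous u},
      forall j, (j < k)%N -> forall x, x \in `]a, b[ ->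
        derivable (iter j (@derive1 R R) u) x 1,
      forall j, (j <= k)%N -> exists2 h, {within `[a, b], continuous h} &
        {in `]a, b[, h =1 iter j (@derive1 R R) u} &
      exists L, forall x y, x \in `]a, b[ -> y \in `]a, b[ ->
        `|iter k (@derive1 R R) u x - iter k (@derive1 R R) u y| <= L * `|x - y|].

(** The endpoints are reached by continuity, in one variable at a time. *)
Lemma lipschitz_oo_cc u L : {within `[a, b], continuous u} ->
  (forall x y, x \in `]a, b[ -> y \in `]a, b[ -> `|u x - u y| <= L * `|x - y|) ->
  forall x y, x \in `[a, b] -> y \in `[a, b] -> `|u x - u y| <= L * `|x - y|.
Proof.
move=> cu uL.
have cphi y : {within `[a, b], continuous (fun x => `|u x - u y| - L * `|x - y|)}.
  have cid : {within `[a, b], continuous (fun x : R => x)}.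
    by apply: continuous_subspaceT => x; exact: cvg_id.
  have cc (c : R) : {within `[a, b], continuous (fun _ : R => c)}.
    by apply: continuous_subspaceT => x; exact: cvg_cst.
  move=> x; apply: cvgB.
    by apply: cvg_norm; apply: cvgB; [exact: cu|exact: cc].
  by apply: cvgMr; apply: cvg_norm; apply: cvgB; [exact: cid|exact: cc].
have H y : y \in `]a, b[ -> forall x, x \in `[a, b] -> `|u x - u y| <= L * `|x - y|.
  move=> yab x xab; rewrite -subr_le0; apply: (ae_le_everywhere (cphi y)) => //.
  by apply: aeT => t tab; rewrite subr_le0 uL.
move=> x y xab yab; rewrite distrC (distrC x) -subr_le0.
apply: (ae_le_everywhere (cphi x)) => //.
by apply: aeT => t tab; rewrite subr_le0 distrC (distrC t) H.
Qed.

(** The continuous extension [h] of the first derivative inherits the regularity of one order less,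
    and the fundamental theorem makes [u] its primitive. At order zero the derivative comes from
    [lipschitz_prim]. *)
Lemma RW_bd k u : RW k u -> exists M, bd a b k.+1 M u.
Proof.
elim: k u => [|k IH] u [cu du eu [L uL]].
  have [h hL uh] := lipschitz_prim ab (lipschitz_oo_cc cu uL).
  have [U uU] := continuous_bmeas cu.
  exists (Num.max U L); split; last first.
    by exists h => //; apply: bmeas_le hL; rewrite le_max lexx orbT.
  by move=> x xab; have [_ H] := uU; rewrite le_max H.
have [h ch hu] := eu 1%N isT.
have hj j : {in `]a, b[, iter j (@derive1 R R) h =1 iter j.+1 (@derive1 R R) u}.
  by rewrite iterSr; exact: iter_derive1_oo.
have [|M hM] := IH h.
  split => //.
  - move=> j jk x xab; apply: (derivable_itv_oo xab (u := iter j.+1 (@derive1 R R) u)).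
      by move=> t tab; rewrite hj.
    exact: du.
  - move=> j jk; have [h' ch' h'u] := eu j.+1 jk.
    by exists h' => // t tab; rewrite h'u// hj.
  - by exists L => x y xab yab; rewrite !hj//; exact: uL.
have [U [_ uU]] := continuous_bmeas cu.
exists (Num.max U M); split; first by move=> x xab; rewrite le_max uU.
exists h; first by apply: bd_le hM; rewrite le_max lexx orbT.
move=> x xab; apply: prim_FTC => // t tab; split; first exact: (du 0%N).
by rewrite hu.
Qed.

Lemma derive1_prim_cst h u x : x \in `]a, b[ ->
  (forall x, x \in `[a, b] -> u x = u a + prim a h x) ->
  derivable (prim a h) x 1 -> derivable u x 1 /\ derive1 u x = derive1 (prim a h) x.
Proof.
move=> xab uh dh.
have E : {in `]a, b[, (fun t => u a + prim a h t) =1 u}.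
  by move=> t /subset_itv_oo_cc tab; rewrite -uh.
have dsum := is_derive_addl (u a) dh erefl.
have [d1 d2] := dsum; split; first exact: (derivable_itv_oo xab E).
by rewrite -(derive1_itv_oo xab E) derive1E.
Qed.

Lemma bd_derive k M h u x : bd a b k.+1 M h ->
  (forall x, x \in `[a, b] -> u x = u a + prim a h x) -> x \in `]a, b[ ->
  derivable u x 1 /\ derive1 u x = h x.
Proof.
move=> hM uh xab; have [d1 d2] := prim_derivable (bdS_continuous ab hM) xab.
by have [? ->] := derive1_prim_cst xab uh d1.
Qed.

Lemma bd_derive_ae M h u : bmeas a b M h ->
  (forall x, x \in `[a, b] -> u x = u a + prim a h x) ->
  {ae mu, forall x, x \in `]a, b[ -> derivable u x 1 /\ derive1 u x = h x}.
Proof.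
move=> hM uh; apply: (aeS _ (prim_derivable_ae (bmeas_integrable hM))).
move=> x H xab; have [d1 d2] := H xab.
by have [? ->] := derive1_prim_cst xab uh d1.
Qed.

Lemma bd_RW k M u : bd a b k.+1 M u -> RW k u.
Proof.
elim: k u => [|k IH] u uM; have cu := bdS_continuous ab uM.
  split=> //; first by case=> // _; exists u.
  by exists M => x y xab yab; apply: (bdS_lip ab uM); exact: subset_itv_oo_cc.
have [_ [h hM uh]] := uM; have [ch dh eh [L hL]] := IH h hM.
have uj j : {in `]a, b[, iter j (@derive1 R R) h =1 iter j.+1 (@derive1 R R) u}.
  rewrite iterSr; apply: iter_derive1_oo => x xab.
  by have [_ ->] := bd_derive hM uh xab.
split=> //.
- case=> [_ x xab|j jk x xab]; first by have [] := bd_derive hM uh xab.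
  by apply: (derivable_itv_oo xab (uj j)); exact: dh.
- case=> [_|j jk]; first by exists u.
  by have [h' ch' h'h] := eh j jk; exists h' => // t tab; rewrite h'h// uj.
- by exists L => x y xab yab; rewrite -!uj//; exact: hL.
Qed.

(* Equality of [f] with a representative of the space of order [k]: for
   positive order it must hold at every interior point, since derivatives
   are taken pointwise. *)
Definition agree k f u :=
  if k is 0 then {ae mu, forall x, x \in `[a, b] -> f x = u x}
  else forall x, x \in `]a, b[ -> f x = u x.

Lemma agree_ae k f u : agree k f u -> {ae mu, forall x, x \in `[a, b] -> f x = u x}.
Proof. by case: k => [//|k] fu; apply: ae_itv_oo_cc; exact: aeT. Qed.

Lemma agree_refl k f u : {in `[a, b], f =1 u} -> agree k f u.
Proof.
by case: k => [|k] fu /=; [apply: aeT => x /fu|move=> x /subset_itv_oo_cc /fu].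
Qed.

(** At order zero the derivative of [u] equals [h] only almost everywhere. At positive order [h] is
    continuous and equality holds at every interior point, as [agree] then demands. *)
Lemma agree_derive k M f u h : bd a b k M h ->
  (forall x, x \in `[a, b] -> u x = u a + prim a h x) -> agree k.+1 f u ->
  agree k (derive1 f) h.
Proof.
case: k => [|k] hM uh fu.
  apply: ae_itv_oo_cc; apply: (aeS _ (bd_derive_ae hM uh)) => x H xab.
  by have [_ <-] := H xab; exact: (derive1_itv_oo xab).
move=> x xab; have [_ <-] := bd_derive hM uh xab.
exact: (derive1_itv_oo xab).
Qed.

End RealBridge.

(** * Complex functions as pairs of real functions *)

Section ComplexBridge.
Context {R : realType} (a b : R).
Hypothesis ab : a < b.
Notation mu := (@lebesgue_measure R).
Notation C := R[i].
Implicit Types (g : R -> C) (u v h : R -> R) (z : C) (x y K M N : R) (k j : nat).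

Definition part (i : bool) z : R := if i then complex.Im z else complex.Re z.

Lemma normr_part_le i z : `|part i z| <= cabs z.
Proof.
rewrite -sqrtr_sqr /cabs ler_sqrt ?addr_ge0 ?sqr_ge0//.
by case: i; rewrite /= ?lerDl ?lerDr sqr_ge0.
Qed.

Lemma cabs_ge0 z : 0 <= cabs z.
Proof. exact: sqrtr_ge0. Qed.

Lemma cabs_le z : cabs z <= `|part false z| + `|part true z|.
Proof.
rewrite -[leRHS]ger0_norm ?addr_ge0// -sqrtr_sqr /cabs ler_sqrt ?sqr_ge0//.
rewrite sqrrD /= !real_normK ?num_real// lerD2r lerDl.
by rewrite mulrn_wge0// mulr_ge0.
Qed.

Lemma part_cder i g x : part i (cder g x) = derive1 (fun t => part i (g t)) x.
Proof. by case: i. Qed.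

Lemma part_cder_n i j g :
  (fun t => part i (cder_n j g t)) = iter j (@derive1 R R) (fun t => part i (g t)).
Proof.
elim: j => [//|j IH]; apply/funext => x.
by rewrite [cder_n _ _]iterS part_cder IH.
Qed.

Lemma W_succ k g : W k.+1 a b g <-> forall i, RW a b k (fun t => part i (g t)).
Proof.
have reE j : (fun t => complex.Re (cder_n j g t)) = _ := part_cder_n false j g.
have imE j : (fun t => complex.Im (cder_n j g t)) = _ := part_cder_n true j g.
have reE' j x : complex.Re (cder_n j g x) = _ := congr1 (@^~ x) (reE j).
have imE' j x : complex.Im (cder_n j g x) = _ := congr1 (@^~ x) (imE j).
split=> [[cr ci dg eg [L gL]] i|gW].
  split; first by case: i.
  - move=> j jk x xab; rewrite -part_cder_n.
    by have [] := dg j jk x xab; case: i.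
  - move=> j jk; have [h [hr [hi hg]]] := eg j jk.
    exists (fun t => part i (h t)); first by case: i.
    by move=> x xab; rewrite hg// -part_cder_n.
  - exists L => x y xab yab; rewrite -part_cder_n; apply: le_trans (gL x y xab yab).
    by have := normr_part_le i (cder_n k g x - cder_n k g y); case: i;
      rewrite /= raddfB.
have [cr dr er [L rL]] := gW false; have [ci di ei [K iK]] := gW true.
split=> //.
- by move=> j jk x xab; rewrite reE imE; split; [exact: dr|exact: di].
- move=> j jk; have [r hr hrE] := er j jk; have [s hs hsE] := ei j jk.
  exists (fun t => Complex (r t) (s t)); split=> //; split=> // x xab.
  apply/eqP; rewrite eq_complex/= reE' imE' -hrE// -hsE//.
  by rewrite !eqxx.
- exists (L + K) => x y xab yab; apply: le_trans (cabs_le _) _.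
  by rewrite /= !raddfB/= !reE' !imE' mulrDl lerD// ?rL ?iK.
Qed.

Lemma Linf_norm_le g N : 0 <= N ->
  {ae mu, forall x, x \in `[a, b] -> cabs (g x) <= N} -> (Linf_norm a b g <= N%:E)%E.
Proof.
move=> N0 gN; apply/ess_supP; apply: (aeS _ gN) => x H.
by rewrite lee_fin; case: ifPn => [/H|_].
Qed.

Lemma Linf_norm_ge0 g : (0 <= Linf_norm a b g)%E.
Proof.
apply: ess_sup_gee.
  apply: (@lt_le_trans _ _ (mu `[a, b]%classic)).
    by rewrite /= lebesgue_measure_itv/= lte_fin ab -EFinB lte_fin subr_gt0.
  by apply: le_measure; rewrite ?inE//.
by apply: aeT => x; rewrite lee_fin; case: ifPn => // _; exact: cabs_ge0.
Qed.

Lemma Linf_norm_fine_le g N : 0 <= N ->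
  {ae mu, forall x, x \in `[a, b] -> cabs (g x) <= N} -> fine (Linf_norm a b g) <= N.
Proof.
move=> N0 gN; have H := Linf_norm_le N0 gN; have G := Linf_norm_ge0 g.
by rewrite -lee_fin fineK// ge0_fin_numE// (le_lt_trans H) ?ltry.
Qed.

Lemma Linf_norm_fine_ge g : (Linf_norm a b g < +oo)%E ->
  {ae mu, forall x, x \in `[a, b] -> cabs (g x) <= fine (Linf_norm a b g)}.
Proof.
move=> goo; have H : {ae mu, forall x, ((if x \in `[a, b] then cabs (g x) else 0)%:E
    <= Linf_norm a b g)%E} by exact: ess_sup_ge.
apply: (aeS _ H) => x + xab; rewrite xab -lee_fin fineK// ge0_fin_numE//.
exact: Linf_norm_ge0.
Qed.

Lemma Wnorm_succ k g :
  Wnorm k.+1 a b g = fine (Linf_norm a b g) + Wnorm k a b (cder g).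
Proof.
rewrite /Wnorm big_ord_recl; congr (_ + _); apply: eq_bigr => j _.
by rewrite /cder_n /= -iterSr.
Qed.

Lemma agree_cabs k g (u : bool -> R -> R) M :
  (forall i, agree a b k (fun t => part i (g t)) (u i)) ->
  (forall i, bd a b k M (u i)) ->
  {ae mu, forall x, x \in `[a, b] -> cabs (g x) <= 2 * M}.
Proof.
move=> gu uM; apply: (aeS2 _ (agree_ae (gu false)) (agree_ae (gu true))) => x Hr Hi xab.
apply: le_trans (cabs_le _) _; rewrite Hr// Hi// mulrDl mul1r.
by apply: lerD; exact: (bd_norm (uM _)).
Qed.

Lemma agree_Linf k g (u : bool -> R -> R) M :
  (forall i, agree a b k (fun t => part i (g t)) (u i)) ->
  (forall i, bd a b k M (u i)) ->
  {ae mu, forall x, x \in `[a, b] -> cabs (g x) <= fine (Linf_norm a b g)}.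
Proof.
move=> gu uM; have M0 := bd_ge0 ab (uM false); apply: Linf_norm_fine_ge.
by apply: le_lt_trans (Linf_norm_le _ (agree_cabs gu uM)) (ltry _); rewrite mulr_ge0.
Qed.

(** The factor [k.+1%:R] counts the derivatives in the norm, and 2 the real and imaginary parts. *)
Lemma Wnorm_le k g (u : bool -> R -> R) M :
  (forall i, agree a b k (fun t => part i (g t)) (u i)) ->
  (forall i, bd a b k M (u i)) -> Wnorm k a b g <= k.+1%:R * (2 * M).
Proof.
elim: k g u => [|k IH] g u gu uM; have M0 := bd_ge0 ab (uM false).
  by rewrite /Wnorm big_ord1 mul1r; apply: Linf_norm_fine_le (agree_cabs gu uM); rewrite mulr_ge0.
rewrite Wnorm_succ -natr1 mulrDl mul1r addrC lerD//; last first.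
  by apply: Linf_norm_fine_le (agree_cabs gu uM); rewrite mulr_ge0.
have /choice[h hP] : forall i, exists h, bd a b k M h /\
    forall x, x \in `[a, b] -> u i x = u i a + prim a h x.
  by move=> i; have [_ [h ? ?]] := uM i; exists h.
apply: (IH _ h) => i; last by have [] := hP i.
have [hM uh] := hP i.
rewrite (_ : (fun t => part i (cder g t)) = derive1 (fun t => part i (g t))).
  exact: agree_derive hM uh (gu i).
by apply/funext => x; rewrite part_cder.
Qed.

(** Starting from some bound [M], the norm itself becomes the bound. At order zero the
    representative is truncated at the essential supremum. At higher order the function, being
    continuous, is kept, and only its derivative is replaced by the representative from the
    induction. *)
Lemma Wnorm_bd k g (u : bool -> R -> R) M :
  (forall i, agree a b k (fun t => part i (g t)) (u i)) ->
  (forall i, bd a b k M (u i)) ->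
  exists2 u', forall i, bd a b k (Wnorm k a b g) (u' i) &
    forall i, {ae mu, forall x, x \in `[a, b] -> u' i x = u i x}.
Proof.
have N0 g' : 0 <= fine (Linf_norm a b g') by rewrite fine_ge0// Linf_norm_ge0.
elim: k g u => [|k IH] g u gu uM; have g_ge := agree_Linf gu uM.
  have WE : Wnorm 0 a b g = fine (Linf_norm a b g) by rewrite /Wnorm big_ord1.
  rewrite WE; have := N0 g; set N := fine _ in g_ge * => N0'.
  exists (fun i x => clamp (- N) N (u i x)) => i.
    by apply: clamp_bmeas N0' _; have [] := uM i.
  apply: (aeS2 _ g_ge (agree_ae (gu i))) => x H1 H2 xab; rewrite clamp_id//.
  rewrite in_itv/= -ler_norml -H2//.
  by apply: le_trans (normr_part_le _ _) (H1 xab).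
have /choice[h hP] : forall i, exists h, bd a b k M h /\
    forall x, x \in `[a, b] -> u i x = u i a + prim a h x.
  by move=> i; have [_ [h ? ?]] := uM i; exists h.
have [|i|h' h'W h'h] := IH (cder g) h.
- move=> i; have [hM uh] := hP i.
  rewrite (_ : (fun t => part i (cder g t)) = derive1 (fun t => part i (g t))).
    exact: agree_derive hM uh (gu i).
  by apply/funext => x; rewrite part_cder.
- by have [] := hP i.
exists u; last by move=> i; exact: aeT.
move=> i; rewrite Wnorm_succ; have [hM uh] := hP i.
have W0 : 0 <= Wnorm k a b (cder g) := bd_ge0 ab (h'W false).
split.
  move=> x xab; apply: (@le_trans _ _ (fine (Linf_norm a b g))); last by rewrite lerDl.
  have cu := bdS_continuous ab (uM i).
  have aeN : {ae mu, forall x, x \in `]a, b[ -> `|u i x| <= fine (Linf_norm a b g)}.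
    apply: ae_itv_cc_oo; apply: (aeS2 _ g_ge (agree_ae (gu i))) => t H1 H2 tab.
    by rewrite -H2//; apply: le_trans (normr_part_le _ _) (H1 tab).
  by apply: (ae_le_everywhere ab (u := fun x => `|u i x|)) => // t; apply: cvg_norm; exact: cu.
exists (h' i); first by apply: bd_le (h'W i); rewrite lerDr.
move=> x xab; rewrite uh//; congr (_ + _).
have [mh _] := bd_bmeas ab hM; have [mh' _] := bd_bmeas ab (h'W i).
apply: (ae_eq_prim xab mh mh'); apply: ae_itv_cc_oo.
by apply: (aeS _ (h'h i)) => t H tab; rewrite H.
Qed.

Lemma W_bd k g : W k a b g -> exists M, exists2 u, forall i, bd a b k M (u i) &
  forall i, agree a b k (fun t => part i (g t)) (u i).
Proof.
case: k => [[mr mi goo]|k /W_succ gW].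
  have N0 : 0 <= fine (Linf_norm a b g) by rewrite fine_ge0// Linf_norm_ge0.
  set N := fine _ in N0; exists N, (fun i x => clamp (- N) N (part i (g x))) => i.
    by apply: clamp_bmeas N0 _; case: i.
  apply: (aeS _ (Linf_norm_fine_ge goo)) => x H xab; rewrite clamp_id//.
  rewrite in_itv/= -ler_norml.
  by apply: le_trans (normr_part_le _ _) (H xab).
have [M0 g0] := RW_bd ab (gW false); have [M1 g1] := RW_bd ab (gW true).
exists (Num.max M0 M1), (fun i x => part i (g x)) => i; last exact: agree_refl.
by case: i; [apply: bd_le g1|apply: bd_le g0]; rewrite le_max lexx ?orbT.
Qed.

Lemma W_succ_bd k g : W k.+1 a b g <-> exists M, forall i, bd a b k.+1 M (fun t => part i (g t)).
Proof.
rewrite W_succ; split=> [gW|[M gM] i]; last exact: bd_RW (gM i).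
have [M0 g0] := RW_bd ab (gW false); have [M1 g1] := RW_bd ab (gW true).
exists (Num.max M0 M1) => i.
by case: i; [apply: bd_le g1|apply: bd_le g0]; rewrite le_max lexx ?orbT.
Qed.

End ComplexBridge.

(** * Complex systems as real systems of twice the size *)

Section VectorBridge.
Context {R : realType} (a b : R) (m : nat).
Hypothesis ab : a < b.
Notation mu := (@lebesgue_measure R).
Notation C := R[i].
Notation I := ('I_m * bool)%type.
Implicit Types (x M N : R) (k : nat) (y z f : R -> 'cV[C]_m) (A : R -> 'M[C]_m).
Implicit Types (F u : I -> R -> R) (al : 'I_m -> 'I_m -> bool -> R -> R) (c d : I).

Definition comp y c t : R := part c.2 (y t c.1 ord0).

Definition mparts A i j (e : bool) t : R := part e (A t i j).

(** The real form of a complex matrix, with block rows [Re, - Im] and [Im, Re]. It takes the family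
    [al] of real functions instead of a complex matrix, so that it also applies to bounded
    representatives of the entries. *)
Definition realmx al c d t : R :=
  if c.2 == d.2 then al c.1 d.1 false t
  else if c.2 then al c.1 d.1 true t else - al c.1 d.1 true t.

Lemma cV_comp_eq (v w : 'cV[C]_m) :
  (forall c, part c.2 (v c.1 ord0) = part c.2 (w c.1 ord0)) -> v = w.
Proof.
move=> vw; apply/matrixP => i j; rewrite (ord1 j); apply/eqP; rewrite eq_complex.
by have /= -> := vw (i, false); have /= -> := vw (i, true); rewrite !eqxx.
Qed.

Lemma comp_mulmx A y c t :
  comp (fun t => A t *m y t) c t = \sum_d realmx (mparts A) c d t * comp y d t.
Proof.
case: c => i e; rewrite /comp mxE /= (_ : \sum_d _ =
    \sum_j \sum_e' realmx (mparts A) (i, e) (j, e') t * comp y (j, e') t).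
  case: e; rewrite /= raddf_sum; apply: eq_bigr => j _; rewrite big_bool /realmx /comp /=;
  by rewrite /mparts /=; case: (A t i j) => p q; case: (y t j ord0) => r s /=; ring.
by rewrite pair_bigA.
Qed.

Lemma comp_vder y c x : comp (vder y) c x = derive1 (comp y c) x.
Proof. by rewrite /comp /vder mxE part_cder. Qed.

Lemma comp_Lop A y c x : comp (Lop A y) c x =
  derive1 (comp y c) x + \sum_d realmx (mparts A) c d x * comp y d x.
Proof.
rewrite -comp_vder -comp_mulmx /comp /Lop mxE.
by case: c.2; rewrite /= raddfD.
Qed.

Lemma comp_lin (k : C) y z c t : comp (fun t => k *: y t + z t) c t =
  complex.Re k * comp y c t +
  (if c.2 then 1 else -1) * complex.Im k * comp y (c.1, ~~ c.2) t + comp z c t.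
Proof.
case: c => i e; rewrite /comp !mxE /=; case: k => p q.
by case: (y t i ord0) => r s; case: (z t i ord0) => r' s'; case: e => /=; ring.
Qed.

Lemma compB y z c t : comp (fun t => y t - z t) c t = comp y c t - comp z c t.
Proof. by rewrite /comp !mxE; case: c.2; rewrite /= raddfB. Qed.

Definition vbd k M y := forall c, bd a b k M (comp y c).

Lemma vbd_le k M N y : M <= N -> vbd k M y -> vbd k N y.
Proof. by move=> MN yM c; exact: bd_le (yM c). Qed.

Lemma vbd_lin k M N (e : C) y z : vbd k M y -> vbd k N z ->
  vbd k ((`|complex.Re e| + `|complex.Im e|) * M + N) (fun t => e *: y t + z t).
Proof.
move=> yM zN c.
have := bdD ab (bdD ab (bdZ ab (complex.Re e) (yM c))
  (bdZ ab ((if c.2 then 1 else -1) * complex.Im e) (yM (c.1, ~~ c.2)))) (zN c).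
rewrite normrM (_ : `|if c.2 then 1 else -1| = 1 :> R) ?mul1r; last first.
  by case: c.2; rewrite ?normrN normr1.
by rewrite mulrDl; apply: (bd_eq ab) => t _; rewrite comp_lin.
Qed.

Lemma vbdB k M N y z : vbd k M y -> vbd k N z -> vbd k (M + N) (fun t => y t - z t).
Proof.
by move=> yM zN c; apply: (bd_eq ab _ (bdB ab (yM c) (zN c))) => t _; rewrite compB.
Qed.

Lemma uniform_bd (J : finType) k (u : J -> R -> R) :
  (forall j, exists M, bd a b k M (u j)) -> exists M, forall j, bd a b k M (u j).
Proof.
move=> /choice[M uM]; exists (\sum_j M j) => j; apply: bd_le (uM j).
rewrite (bigD1 j)//= lerDl sumr_ge0// => i _; exact: bd_ge0 (uM i).
Qed.

Lemma Wvec_succ k y : Wvec k.+1 a b y <-> exists M, vbd k.+1 M y.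
Proof.
split=> [yW|[M yM] i]; last first.
  by apply/(W_succ_bd ab); exists M => e; exact: (yM (i, e)).
apply: uniform_bd => -[i e]; have /(W_succ_bd ab)[M yM] := yW i.
by exists M; exact: yM.
Qed.

Lemma Wvec_rep k y : Wvec k a b y -> exists M, exists2 u,
  forall c, bd a b k M (u c) & forall c, agree a b k (comp y c) (u c).
Proof.
move=> yW.
have /choice[u uP] : forall i, exists u : bool -> R -> R, (exists M, forall e, bd a b k M (u e)) /\
    forall e, agree a b k (fun t => part e (y t i ord0)) (u e).
  by move=> i; have [M [u ? ?]] := W_bd ab (yW i); exists u; split=> //; exists M.
have [|M uM] := @uniform_bd _ k (fun c : I => u c.1 c.2).
  by move=> [i e]; have [[M uM] _] := uP i; exists M; exact: uM.
exists M, (fun c => u c.1 c.2) => // -[i e].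
by have [_] := uP i; apply.
Qed.

Lemma Wmat_rep k A : Wmat k a b A -> exists M, exists2 al,
  forall i j e, bd a b k M (al i j e) & forall i j e, agree a b k (mparts A i j e) (al i j e).
Proof.
move=> AW.
have /choice[u uP] : forall ij : 'I_m * 'I_m, exists u : bool -> R -> R,
    (exists M, forall e, bd a b k M (u e)) /\
    forall e, agree a b k (mparts A ij.1 ij.2 e) (u e).
  by move=> ij; have [M [u ? ?]] := W_bd ab (AW ij.1 ij.2); exists u; split=> //; exists M.
have [|M uM] := @uniform_bd _ k (fun c : 'I_m * 'I_m * bool => u c.1 c.2).
  by move=> [ij e]; have [[M uM] _] := uP ij; exists M; exact: uM.
exists M, (fun i j e => u (i, j) e) => i j e; first exact: (uM (i, j, e)).
by have [_] := uP (i, j); apply.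
Qed.

Lemma Wvec_norm_le k y u M : (forall c, agree a b k (comp y c) (u c)) ->
  (forall c, bd a b k M (u c)) -> Wvec_norm k a b y <= m%:R * (k.+1%:R * (2 * M)).
Proof.
move=> yu uM; rewrite /Wvec_norm.
have -> : m%:R * (k.+1%:R * (2 * M)) = \sum_(i < m) k.+1%:R * (2 * M).
  by rewrite sumr_const card_ord mulr_natl.
apply: ler_sum => i _; apply: (Wnorm_le ab (u := fun e => u (i, e))) => e.
  exact: (yu (i, e)).
exact: (uM (i, e)).
Qed.

Lemma Wvec_norm_rep k y u M : (forall c, agree a b k (comp y c) (u c)) ->
  (forall c, bd a b k M (u c)) ->
  exists2 u', forall c, bd a b k (Wvec_norm k a b y) (u' c) &
    forall c, {ae mu, forall x, x \in `[a, b] -> u' c x = u c x}.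
Proof.
move=> yu uM.
have /choice[u' uP] : forall i, exists u' : bool -> R -> R,
    (forall e, bd a b k (Wnorm k a b (fun t => y t i ord0)) (u' e)) /\
    forall e, {ae mu, forall x, x \in `[a, b] -> u' e x = u (i, e) x}.
  move=> i; have [e|e|u' ? ?] := @Wnorm_bd _ _ _ ab k (fun t => y t i ord0) (fun e => u (i, e)) M.
  - exact: (yu (i, e)).
  - exact: (uM (i, e)).
  - by exists u'.
exists (fun c => u' c.1 c.2) => -[i e]; last by have [_] := uP i; apply.
have [u'W _] := uP i; apply: bd_le (u'W e).
rewrite /Wvec_norm (bigD1 i)//= lerDl sumr_ge0// => j _.
by have [H _] := uP j; exact: bd_ge0 (H false).
Qed.

Lemma Wmat_norm_rep k A al M : (forall i j e, agree a b k (mparts A i j e) (al i j e)) ->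
  (forall i j e, bd a b k M (al i j e)) ->
  exists2 al', forall i j e, bd a b k (Wmat_norm k a b A) (al' i j e) &
    forall i j e, {ae mu, forall x, x \in `[a, b] -> al' i j e x = al i j e x}.
Proof.
move=> yu uM.
have /choice[u' uP] : forall ij : 'I_m * 'I_m, exists u' : bool -> R -> R,
    (forall e, bd a b k (Wnorm k a b (fun t => A t ij.1 ij.2)) (u' e)) /\
    forall e, {ae mu, forall x, x \in `[a, b] -> u' e x = al ij.1 ij.2 e x}.
  move=> [i j]; have [e|e|u' ? ?] := @Wnorm_bd _ _ _ ab k (fun t => A t i j) (al i j) M.
  - exact: yu.
  - exact: uM.
  - by exists u'.
exists (fun i j e => u' (i, j) e) => i j e; last by have [_] := uP (i, j); apply.
have [u'W _] := uP (i, j); apply: bd_le (u'W e).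
have W0 i' j' : 0 <= Wnorm k a b (fun t => A t i' j').
  by have [H _] := uP (i', j'); exact: bd_ge0 (H false).
rewrite /Wmat_norm (bigD1 i)//= (bigD1 j)//= -addrA lerDl.
by rewrite addr_ge0// sumr_ge0// => i' _; rewrite sumr_ge0.
Qed.

Lemma realmx_bd k M al : (forall i j e, bd a b k M (al i j e)) ->
  forall c d, bd a b k M (realmx al c d).
Proof.
move=> alM [i e] [j e']; rewrite /realmx /=.
by case: eqP => _ //; case: e => //; exact: bdN.
Qed.

Lemma eq_realmx al al' c d t : (forall i j e, al i j e t = al' i j e t) ->
  realmx al c d t = realmx al' c d t.
Proof. by move=> E; rewrite /realmx !E. Qed.

Lemma ae_comp_Lop k M A al y :
  (forall i j e, {ae mu, forall x, x \in `[a, b] -> mparts A i j e x = al i j e x}) ->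
  vbd k.+1 M y ->
  exists2 h : I -> R -> R, (forall c, bmeas a b M (h c)) /\
    (forall c x, x \in `[a, b] -> comp y c x = comp y c a + prim a (h c) x) &
    {ae mu, forall x, x \in `]a, b[ -> forall c, comp (Lop A y) c x =
       h c x + \sum_d realmx al c d x * comp y d x}.
Proof.
move=> Aal yM.
have /choice[h hP] : forall c, exists h, bmeas a b M h /\
    forall x, x \in `[a, b] -> comp y c x = comp y c a + prim a h x.
  by move=> c; have [_ [h /(bd_bmeas ab) ? ?]] := yM c; exists h.
exists h; first by split=> c; have [] := hP c.
have dh c := let: conj hM yh := hP c in bd_derive_ae hM yh.
have Aal' (p : 'I_m * 'I_m * bool) := Aal p.1.1 p.1.2 p.2.
apply: (aeS2 _ (ae_fin dh) (ae_fin Aal')) => x Hd HA xab c.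
rewrite comp_Lop; have [_ ->] := Hd c xab; congr (_ + _).
apply: eq_bigr => d _; congr (_ * _); apply: eq_realmx => i j e.
exact: (HA (i, j, e) (subset_itv_oo_cc xab)).
Qed.

(** The differential equation says that the derivative [h] of [comp y] equals [rhs] almost
    everywhere; the two therefore have the same primitive. *)
Lemma integral_eq_ae k M M' N A al F y :
  (forall i j e, bmeas a b M' (al i j e)) ->
  (forall i j e, {ae mu, forall x, x \in `[a, b] -> mparts A i j e x = al i j e x}) ->
  vbd k.+1 M y -> (forall c, bmeas a b N (F c)) ->
  (forall c, {ae mu, forall x, x \in `]a, b[ -> comp (Lop A y) c x = F c x}) ->
  integral_eq a b (realmx al) F (comp y).
Proof.
move=> alM Aal yM FN LF c x xab; have [h [hM yh] hL] := ae_comp_Lop Aal yM.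
rewrite (yh c)//; congr (_ + _).
have [mh _] := hM c.
have [mr _] := @rhs_bd _ _ _ _ ab 0 _ _ _ _ _ _ (realmx_bd (k := 0) alM) FN
  (fun c => bd_bmeas ab (yM c)) c.
apply: (ae_eq_prim xab mh mr); apply: (aeS2 _ hL (LF c)) => t H1 H2 tab.
by rewrite /rhs -H2// H1// addrK.
Qed.

(** A primitive of [rhs] has derivative [rhs] almost everywhere. The exceptional sets are united
    over the finitely many components and entries. *)
Lemma ae_integral_eq k M M' N A al F f y :
  (forall i j e, bmeas a b M' (al i j e)) ->
  (forall i j e, {ae mu, forall x, x \in `[a, b] -> mparts A i j e x = al i j e x}) ->
  vbd k.+1 M y -> (forall c, bmeas a b N (F c)) ->
  (forall c, {ae mu, forall x, x \in `[a, b] -> comp f c x = F c x}) ->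
  integral_eq a b (realmx al) F (comp y) ->
  {ae mu, forall x, x \in `]a, b[ -> Lop A y x = f x}.
Proof.
move=> alM Aal yM FN fF yeq.
have rb := @rhs_bd _ _ _ _ ab 0 _ _ _ _ _ _ (realmx_bd (k := 0) alM) FN
  (fun c => bd_bmeas ab (yM c)).
have dr c := bd_derive_ae (rb c) (yeq c).
have Aal' (p : 'I_m * 'I_m * bool) := Aal p.1.1 p.1.2 p.2.
apply: (aeS3 _ (ae_fin dr) (ae_fin Aal') (ae_fin fF)) => x Hd HA Hf xab.
have xab' := subset_itv_oo_cc xab.
apply: cV_comp_eq => c; rewrite -/(comp (Lop A y) c x) -/(comp f c x) Hf// comp_Lop.
have [_ ->] := Hd c xab; rewrite /rhs.
rewrite [X in _ + X](_ : _ = \sum_d realmx al c d x * comp y d x) ?subrK//.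
apply: eq_bigr => d _; congr (_ * _); apply: eq_realmx => i j e.
exact: (HA (i, j, e) xab').
Qed.

(* [Lop A y] itself need not lie in the Sobolev space, since [vder y] takes
   arbitrary values at the endpoints. *)
Lemma Lop_rep k M M' A al y : (forall i j e, bd a b k M' (al i j e)) ->
  (forall i j e, agree a b k (mparts A i j e) (al i j e)) -> vbd k.+1 M y ->
  exists2 F, forall c, bd a b k (M + #|{: I}|%:R * (2 ^+ k * (M' * M))) (F c) &
    forall c, agree a b k (comp (Lop A y) c) (F c).
Proof.
move=> alM Aal yM.
have /choice[h hP] : forall c, exists h, bd a b k M h /\
    forall x, x \in `[a, b] -> comp y c x = comp y c a + prim a h x.
  by move=> c; have [_ [h ? ?]] := yM c; exists h.
exists (fun c x => h c x + \sum_d realmx al c d x * comp y d x) => c.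
  have [hM _] := hP c; apply: (bdD ab hM).
  have -> : #|{: I}|%:R * (2 ^+ k * (M' * M)) = \sum_(d : I) 2 ^+ k * (M' * M).
    by rewrite sumr_const mulr_natl.
  apply: bd_sum => // d; apply: bdM => //; first exact: realmx_bd.
  exact: bd_pred.
have [hM yh] := hP c; have dh : agree a b k (derive1 (comp y c)) (h c).
  by apply: (agree_derive ab hM yh); exact: agree_refl.
have E x : (forall i j e, mparts A i j e x = al i j e x) -> derive1 (comp y c) x = h c x ->
    comp (Lop A y) c x = h c x + \sum_d realmx al c d x * comp y d x.
  move=> HA Hd; rewrite comp_Lop Hd; congr (_ + _).
  by apply: eq_bigr => d _; congr (_ * _); exact: eq_realmx.
(* At order zero the identities hold off a null set, at positive order at each interior point; these
   are the two forms of [agree]. *)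
case: k => [|k] in alM Aal yM h hP hM yh dh E *.
  have Aal' (p : 'I_m * 'I_m * bool) := Aal p.1.1 p.1.2 p.2.
  apply: (aeS2 _ dh (ae_fin Aal')) => x Hd HA xab; apply: E; last exact: Hd.
  by move=> i j e; exact: (HA (i, j, e) xab).
move=> x xab; apply: E; last exact: dh.
by move=> i j e; exact: Aal.
Qed.

End VectorBridge.

(** * The initial value problem *)

Section CVNorm.
Context {R : realType} (m : nat).
Implicit Types (v w : 'cV[R[i]]_m).

Lemma cabs_normc (z : R[i]) : (cabs z)%:C%C = `|z|.
Proof. by rewrite normc_def. Qed.

Lemma cabsD (z w : R[i]) : cabs (z + w) <= cabs z + cabs w.
Proof.
by have := ler_normD z w; rewrite -!cabs_normc -rmorphD lecR.
Qed.

Lemma cabsM (z w : R[i]) : cabs (z * w) = cabs z * cabs w.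
Proof.
by have := normrM z w; rewrite -!cabs_normc -rmorphM => /complexI.
Qed.

Lemma cabsN (z : R[i]) : cabs (- z) = cabs z.
Proof. by have := normrN z; rewrite -!cabs_normc => /complexI. Qed.

Lemma cabs_eq0 (z : R[i]) : cabs z <= 0 -> z = 0.
Proof.
by move=> z0; apply/eqP; rewrite -normr_le0 -cabs_normc lecR.
Qed.

Lemma cvnorm_ge0 v : 0 <= cvnorm v.
Proof. by apply: sumr_ge0 => i _; exact: cabs_ge0. Qed.

Lemma cvnormD v w : cvnorm (v + w) <= cvnorm v + cvnorm w.
Proof. by rewrite -big_split; apply: ler_sum => i _; rewrite mxE cabsD. Qed.

Lemma cvnormZ (c : R[i]) v : cvnorm (c *: v) = cabs c * cvnorm v.
Proof. by rewrite /cvnorm mulr_sumr; apply: eq_bigr => i _; rewrite mxE cabsM. Qed.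

Lemma cvnormN v : cvnorm (- v) = cvnorm v.
Proof. by apply: eq_bigr => i _; rewrite mxE cabsN. Qed.

Lemma cvnormB v w : cvnorm (v - w) <= cvnorm v + cvnorm w.
Proof. by rewrite -(cvnormN w) cvnormD. Qed.

Lemma cvnorm0 : cvnorm (0 : 'cV[R[i]]_m) = 0.
Proof. by rewrite /cvnorm big1// => i _; rewrite mxE /cabs /= expr0n addr0 sqrtr0. Qed.

Lemma cvnorm_eq0 v : cvnorm v <= 0 -> v = 0.
Proof.
move=> v0; have /eqP : cvnorm v = 0 by apply/eqP; rewrite eq_le v0 cvnorm_ge0.
rewrite psumr_eq0 => [/allP H|i _]; last exact: cabs_ge0.
apply/matrixP => i j; rewrite (ord1 j) mxE; apply: cabs_eq0.
by have /eqP -> := H i (mem_index_enum i).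
Qed.

Lemma cvnorm_sum (J : Type) (r : seq J) (F : J -> 'cV[R[i]]_m) :
  cvnorm (\sum_(j <- r) F j) <= \sum_(j <- r) cvnorm (F j).
Proof.
elim: r => [|j r IH]; first by rewrite !big_nil cvnorm0.
by rewrite !big_cons (le_trans (cvnormD _ _))// lerD2l.
Qed.

Lemma cabs_le_cvnorm v i : cabs (v i ord0) <= cvnorm v.
Proof. by rewrite /cvnorm (bigD1 i)//= lerDl sumr_ge0// => j _; exact: cabs_ge0. Qed.

Lemma cabs_real (r : R) : cabs r%:C%C = `|r|.
Proof. by rewrite /cabs /= expr0n addr0 sqrtr_sqr. Qed.

End CVNorm.

Section InitialValueProblem.
Context {R : realType} (a b : R) (m k : nat).
Hypothesis ab : a < b.
Notation mu := (@lebesgue_measure R).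
Notation C := R[i].
Notation I := ('I_m * bool)%type.
Implicit Types (x M N Q : R) (y z f : R -> 'cV[C]_m) (A : R -> 'M[C]_m).
Implicit Types (F u : I -> R -> R) (al : 'I_m -> 'I_m -> bool -> R -> R) (c d : I).

Definition assemble u : R -> 'cV[C]_m :=
  fun t => \col_i Complex (u (i, false) t) (u (i, true) t).

Lemma comp_assemble u c : comp (assemble u) c = u c.
Proof. by apply/funext => t; case: c => i [] /=; rewrite /comp mxE. Qed.

(** The iteration at order zero yields a bounded solution; the a priori estimate then supplies its
    derivatives up to order [k.+1]. *)
Lemma Lop_exists A f (q : 'cV[C]_m) : Wmat k a b A -> Wvec k a b f ->
  exists y, [/\ Wvec k.+1 a b y,
    {ae mu, forall x, x \in `]a, b[ -> Lop A y x = f x} & y a = q].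
Proof.
move=> /(Wmat_rep ab)[M [al alM Aal]] /(Wvec_rep ab)[N [F FN fF]].
have alM' i j e := bd_bmeas ab (alM i j e).
have FN' c := bd_bmeas ab (FN c).
have [u [uq ueq [S uS]]] := integral_eq_exists ab (fun c : I => part c.2 (q c.1 ord0))
  (realmx_bd ab (k := 0) alM') FN'.
have [K _ HK] := @integral_eq_apriori _ a b I ab k M.
have uK := HK _ _ _ _ (\sum_c `|u c a|) _ (realmx_bd ab alM) FN uS _ ueq.
have {}uK : vbd a b k.+1 (K * (N + \sum_c `|u c a|)) (assemble u).
  move=> c; rewrite comp_assemble; apply: uK => d.
  by rewrite (bigD1 d)//= lerDl sumr_ge0.
exists (assemble u); split.
- by apply/(Wvec_succ ab); eexists; exact: uK.
- apply: (ae_integral_eq ab alM' _ uK FN').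
  + by move=> i j e; exact: agree_ae (Aal i j e).
  + by move=> c; exact: agree_ae (fF c).
  + move=> c x xab; rewrite !comp_assemble (ueq c x xab); congr (_ + _).
    apply: (eq_prim xab) => t _; rewrite /rhs; congr (_ - _).
    by apply: eq_bigr => d _; rewrite comp_assemble.
- by apply: cV_comp_eq => c; rewrite -/(comp (assemble u) c a) comp_assemble uq.
Qed.

Lemma Lop_apriori M : exists2 K, 0 <= K & forall A al y F N Q,
  (forall i j e, bd a b k M (al i j e)) ->
  (forall i j e, {ae mu, forall x, x \in `[a, b] -> mparts A i j e x = al i j e x}) ->
  Wvec k.+1 a b y -> (forall c, bd a b k N (F c)) ->
  (forall c, {ae mu, forall x, x \in `]a, b[ -> comp (Lop A y) c x = F c x}) ->
  cvnorm (y a) <= Q -> vbd a b k.+1 (K * (N + Q)) y.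
Proof.
have [K K0 HK] := @integral_eq_apriori _ a b I ab k M.
exists K => // A al y F N Q alM Aal /(Wvec_succ ab)[S yS] FN LF yQ c.
have alM' i j e := bd_bmeas ab (alM i j e).
have yeq := integral_eq_ae ab alM' Aal yS (fun c => bd_bmeas ab (FN c)) LF.
apply: HK (realmx_bd ab alM) FN (fun c => bd_bmeas ab (yS c)) _ yeq c => d.
apply: le_trans yQ; apply: le_trans (normr_part_le _ _) _.
exact: cabs_le_cvnorm.
Qed.

End InitialValueProblem.

(** * Uniform boundedness *)

Section BoundedOperators.
Context {R : realType} (a b : R) (m k : nat).
Hypothesis ab : a < b.
Notation C := R[i].
Notation fn := (R -> 'cV[C]_m).
Implicit Types (x M N Q K S r : R) (y z f : fn) (L : fn -> 'cV[C]_m) (j : nat).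

Local Notation vbd := (vbd a b k.+1).
Local Notation Wvec := (Wvec k.+1 a b).
Local Notation blo := (bounded_linear_op k.+1 a b).

Lemma vbd_Wvec M y : vbd M y -> Wvec y.
Proof. by move=> yM; apply/(Wvec_succ ab); exists M. Qed.

Lemma vbd0 : vbd 0 (fun=> 0 : 'cV[C]_m).
Proof.
move=> c; apply: (bd_eq ab _ (bd0 a b k.+1)) => t _.
by rewrite /comp mxE; case: c.2.
Qed.

Lemma Wvec_lin (e : C) y z : Wvec y -> Wvec z -> Wvec (fun t => e *: y t + z t).
Proof.
move=> /(Wvec_succ ab)[M yM] /(Wvec_succ ab)[N zN].
exact: vbd_Wvec (vbd_lin ab e yM zN).
Qed.

Lemma comp_real r y z c t :
  comp (fun t => r%:C%C *: y t + z t) c t = r * comp y c t + comp z c t.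
Proof. by rewrite comp_lin /= mulr0 mul0r addr0. Qed.

Lemma vbdZ r M y : vbd M y -> vbd (`|r| * M) (fun t => r%:C%C *: y t + 0).
Proof.
by move=> yM; have := vbd_lin ab r%:C%C yM vbd0; rewrite /= normr0 !addr0.
Qed.

Lemma blo_lin L (e : C) y z : blo L -> Wvec y -> Wvec z ->
  L (fun t => e *: y t + z t) = e *: L y + L z.
Proof. by move=> [H _]; exact: H. Qed.

Lemma blo0 L : blo L -> L (fun=> 0) = 0.
Proof.
move=> bL; have W0 := vbd_Wvec vbd0.
have := blo_lin 1 bL W0 W0.
rewrite (_ : (fun t => _) = fun=> 0); last by apply/funext => t; rewrite scaler0 addr0.
by rewrite scale1r => /eqP; rewrite -subr_eq0 opprD addNKr oppr_eq0 => /eqP.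
Qed.

Lemma bloZ L (e : C) y : blo L -> Wvec y -> L (fun t => e *: y t + 0) = e *: L y.
Proof. by move=> bL yW; rewrite (blo_lin e bL yW (vbd_Wvec vbd0)) blo0// addr0. Qed.

Lemma bloB L y z : blo L -> Wvec y -> Wvec z -> L (fun t => y t - z t) = L y - L z.
Proof.
move=> bL yW zW; have := blo_lin (-1) bL zW yW; rewrite scaleN1r addrC => <-.
by congr L; apply/funext => t; rewrite scaleN1r addrC.
Qed.

(** Trades the Sobolev norm for the constants of [vbd], at the price of the factor in
    [Wvec_norm_le]. The absolute value is taken because the constant in [bounded_linear_op] may be
    negative. *)
Lemma blo_bound L : blo L -> exists2 K, 0 <= K &
  forall M y, 0 <= M -> vbd M y -> cvnorm (L y) <= K * M.
Proof.
move=> [_ [K LK]]; exists (`|K| * (m%:R * (k.+2%:R * 2))); first by rewrite !mulr_ge0.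
move=> M y M0 yM; apply: (le_trans (LK y (vbd_Wvec yM))).
have H : Wvec_norm k.+1 a b y <= m%:R * (k.+2%:R * (2 * M)).
  by apply: (Wvec_norm_le ab _ yM) => c; exact: agree_refl.
have W0 : 0 <= Wvec_norm k.+1 a b y.
  have yy c : agree a b k.+1 (comp y c) (comp y c) by exact: agree_refl.
  have [u' u'W _] := Wvec_norm_rep ab yy yM.
  have [i _|m0] := pickP (@predT 'I_m); first exact: (bd_ge0 ab (u'W (i, false))).
  by rewrite /Wvec_norm big1// => i; have := m0 i.
apply: (@le_trans _ _ (`|K| * Wvec_norm k.+1 a b y)).
  by rewrite ler_wpM2r ?ler_norm.
by rewrite -!mulrA ler_wpM2l// (le_trans H)// -?mulrA.
Qed.

(** [S] is the supremum of [cvnorm (L z)] over the unit ball [vbd 1], an operator norm. The vector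
    in the assumption forces [e <= S]; hence [S] is positive and [3 / 4 * S] is exceeded on the
    ball. *)
Lemma near_maximizer L (e : R) : blo L -> 0 < e ->
  (exists M, exists2 y, 0 <= M /\ vbd M y & e * M < cvnorm (L y)) ->
  exists S, exists y, [/\ vbd 1 y, e <= S, 3 / 4 * S <= cvnorm (L y) &
    forall M z, 0 <= M -> vbd M z -> cvnorm (L z) <= S * M].
Proof.
move=> bL e0 [M [y [M0 yM] eMy]]; have [K K0 LK] := blo_bound bL.
pose E := [set r | exists2 z, vbd 1 z & r = cvnorm (L z)].
have Esup : has_sup E.
  split; first by exists (cvnorm (L (fun=> 0))), (fun=> 0) => //; exact: vbd_le ler01 vbd0.
  by exists K => _ [z z1 ->]; rewrite -[K]mulr1; exact: LK.
have ES z : vbd 1 z -> cvnorm (L z) <= sup E.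
  by move=> z1; apply: ub_le_sup; [case: Esup|exists z].
have bnd N z : 0 <= N -> vbd N z -> cvnorm (L z) <= sup E * N.
  rewrite le_eqVlt => /predU1P[<-|N0] zN.
    by rewrite mulr0; apply: le_trans (LK 0 z _ zN) _; rewrite ?mulr0.
  have := vbdZ N^-1 zN; rewrite gtr0_norm ?invr_gt0// mulVf ?gt_eqF// => /ES.
  rewrite (bloZ _ bL (vbd_Wvec zN)) cvnormZ cabs_real gtr0_norm ?invr_gt0//.
  by rewrite mulrC ler_pdivrMr.
have eS : e <= sup E.
  move: M0; rewrite le_eqVlt => /predU1P[M0|M0].
    have yM0 : vbd 0 y by rewrite M0.
    have := LK 0 y (lexx _) yM0; rewrite mulr0 => H.
    by move: eMy; rewrite -M0 mulr0 ltNge H.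
  by have := lt_le_trans eMy (bnd M y (ltW M0) yM); rewrite ltr_pM2r// => /ltW.
have S0 : 0 < sup E := lt_le_trans e0 eS.
have [_ [z z1 ->] Hz] := @sup_adherent _ E (sup E / 4) (divr_gt0 S0 (ltr0n _ 4)) Esup.
by exists (sup E), z; split=> //; lra.
Qed.

Lemma half_sum_le_max (s t r : R) : 2 * r <= s + t -> r <= Num.max s t.
Proof. by move=> st; case: (leP s t) => ?; lra. Qed.

(* Sokal's proof of the uniform boundedness principle: the sign of each new
   term is chosen so that adding it does not decrease the norm. *)
Lemma gliding_hump (L : nat -> fn -> 'cV[C]_m) : (forall j, blo (L j)) ->
  (forall j, exists M, exists2 y, 0 <= M /\ vbd M y &
     j.+1%:R * 4 ^+ j * M < cvnorm (L j y)) ->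
  exists2 x, Wvec x & forall j, j.+1%:R / 4 <= cvnorm (L j x).
Proof.
move=> bL big.
have /choice[y yP] : forall j, exists y, exists S, [/\ vbd 1 y, j.+1%:R * 4 ^+ j <= S,
    3 / 4 * S <= cvnorm (L j y) &
    forall M z, 0 <= M -> vbd M z -> cvnorm (L j z) <= S * M].
  move=> j; have [|S [y H]] := near_maximizer (bL j) _ (big j); last by exists y, S.
  by rewrite mulr_gt0// exprn_gt0.
have y1 j : vbd 1 (y j) by have [S []] := yP j.
pose sg j (p : fn) : R :=
  if cvnorm (L j (fun t => (geo j)%:C%C *: y j t + p t)) <
     cvnorm (L j (fun t => (- geo j)%:C%C *: y j t + p t)) then - geo j else geo j.
pose xs := fix xs j : fn := if j is i.+1 then
   fun t => (sg i (xs i))%:C%C *: y i t + xs i t else fun=> 0.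
have xsS j : xs j.+1 = fun t => (sg j (xs j))%:C%C *: y j t + xs j t by [].
have sgE j p : `|sg j p| = geo j.
  by rewrite /sg; case: ifP; rewrite ?normrN gtr0_norm ?geo_gt0.
have xsW j : Wvec (xs j).
  by elim: j => [|j IH]; [exact: vbd_Wvec vbd0|apply: Wvec_lin IH; exact: vbd_Wvec].
have low j : geo j * cvnorm (L j (y j)) <= cvnorm (L j (xs j.+1)).
  have yW := vbd_Wvec (y1 j).
  set v := L j (y j); set p := L j (xs j).
  have Lp e : L j (fun t => e%:C%C *: y j t + xs j t) = e%:C%C *: v + p.
    exact: (blo_lin _ (bL j) yW (xsW j)).
  (* The two candidates differ by [2 * geo j] times [v], so one of them has norm at least
     [geo j * cvnorm v]. *)
  have tri : 2 * (geo j * cvnorm v) <=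
      cvnorm ((geo j)%:C%C *: v + p) + cvnorm ((- geo j)%:C%C *: v + p).
    apply: le_trans (cvnormB _ _).
    rewrite opprD addrACA subrr addr0 -scalerBl -rmorphB cvnormZ cabs_real.
    rewrite opprK mulrA ler_wpM2r ?cvnorm_ge0//.
    by apply: le_trans (ler_norm _); rewrite mulr_natl mulr2n.
  have := half_sum_le_max tri; rewrite xsS Lp /sg !Lp.
  by case: ltP.
pose D j c t := comp (xs j.+1) c t - comp (xs j) c t.
have Db c j : bd a b k.+1 (1 * geo j) (D j c).
  have := bdZ ab (sg j (xs j)) (y1 j c); rewrite sgE mulrC.
  by apply: (bd_eq ab) => t _; rewrite /D xsS comp_real addrK.
pose x := assemble (fun c => series_fun (fun j => D j c)).
have xB j : vbd (2 * 1 * geo j) (fun t => x t - xs j t).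
  move=> c; apply: (bd_eq ab _ (bd_geo_series ab (Db c) j)) => t _.
  rewrite compB comp_assemble (telescope_sumr (fun i => comp (xs i) c t))//.
  by rewrite (_ : comp (xs 0) c t = 0) ?subr0// /comp mxE; case: c.2.
have xW : Wvec x.
  have := Wvec_lin 1 (vbd_Wvec (xB 0%N)) (xsW 0%N); congr Wvec.
  by apply/funext => t; rewrite scale1r subrK.
exists x => // j; have [S [_ S4 yS LS]] := yP j.
have rest := LS _ _ _ (xB j.+1); rewrite bloB// in rest.
have g0 := @geo_gt0 R j; have lowj := low j.
have := cvnormB (L j x) (L j x - L j (xs j.+1)); rewrite opprB addrC subrK => tri.
(* The tail after step [j] contributes at most [S * (2 * geo j.+1)], that is [geo j * S / 2],
   against at least [3 / 4 * (geo j * S)] from step [j]. A quarter of [geo j * S] remains, and the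
   factor [4 ^+ j] in the assumption makes [geo j * S] at least [j.+1]. *)
have {}rest : cvnorm (L j x - L j (xs j.+1)) <= geo j * S / 2.
  by apply: le_trans (rest _) _; rewrite ?mulr_ge0 ?(ltW (geo_gt0 _))// geoS; lra.
have gS : j.+1%:R <= geo j * S.
  apply: le_trans (ler_wpM2l (ltW g0) S4).
  by rewrite mulrCA /geo exprVn mulVf ?mulr1// expf_neq0.
have := ler_wpM2l (ltW g0) yS; lra.
Qed.

(** Pointwise convergence bounds [B e y] only below a threshold that depends on [y]. If no uniform
    bound exists, there are parameters [e j < 1 / j.+1] at which the operator norm exceeds
    [j.+1 * 4 ^ j]; the gliding hump then provides a single [x] along which the values are
    unbounded. *)
Lemma uniform_boundedness (B : R -> fn -> 'cV[C]_m) eps0 : 0 < eps0 ->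
  (forall e, 0 <= e -> e < eps0 -> blo (B e)) ->
  (forall y, Wvec y -> forall eta, 0 < eta -> exists2 d, 0 < d &
     forall e, 0 < e -> e < d -> e < eps0 -> cvnorm (B e y - B 0 y) < eta) ->
  exists2 d, 0 < d <= eps0 & exists2 K, 0 <= K & forall e, 0 < e -> e < d ->
    forall M y, 0 <= M -> vbd M y -> cvnorm (B e y) <= K * M.
Proof.
move=> eps00 bB cvB; apply: contrapT => nK.
have /choice[e eP] : forall j, exists e : R, [/\ 0 < e, e < j.+1%:R^-1, e < eps0 &
    exists M, exists2 y, 0 <= M /\ vbd M y & j.+1%:R * 4 ^+ j * M < cvnorm (B e y)].
  move=> j; apply: contrapT => ne; apply: nK.
  exists (Num.min eps0 j.+1%:R^-1); first by rewrite lt_min eps00 invr_gt0 ltr0n ge_min lexx.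
  exists (j.+1%:R * 4 ^+ j); first by rewrite mulr_ge0// exprn_ge0.
  move=> e e0; rewrite lt_min => /andP[e1 e2] M y M0 yM.
  by rewrite leNgt; apply/negP => H; apply: ne; exists e; split=> //; exists M, y.
have [|j|x xW Hx] := @gliding_hump (fun j => B (e j)).
- by move=> j; have [e0 _ e1 _] := eP j; apply: bB => //; exact: ltW.
- by have [] := eP j.
have [d d0 Hd] := cvB x xW 1 ltr01.
(* Once [j.+1] exceeds [Z], [e j] is below [d] and [j.+1 / 4] is above [cvnorm (B 0 x) + 1], against
   the convergence at [x]. *)
pose Z := d^-1 + 4 * (cvnorm (B 0 x) + 1).
have Z0 : 0 <= Z by rewrite addr_ge0 ?invr_ge0 ?(ltW d0)// mulr_ge0// addr_ge0// cvnorm_ge0.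
have := truncnS_gt Z; set j := Num.truncn Z => jZ.
have [e0 ej e1 _] := eP j.
have dj : j.+1%:R^-1 <= d.
  rewrite -[d]invrK lef_pV2 ?posrE ?invr_gt0// ltW// (le_lt_trans _ jZ)//.
  by rewrite lerDl mulr_ge0// addr_ge0// cvnorm_ge0.
have := Hd _ e0 (lt_le_trans ej dj) e1; have := Hx j.
have := cvnormD (B (e j) x - B 0 x) (B 0 x); rewrite subrK.
have di : 0 < d^-1 by rewrite invr_gt0.
move: jZ; rewrite /Z; lra.
Qed.

End BoundedOperators.

Lemma Wvec_cst0 {R : realType} (a b : R) m k : a < b -> Wvec k a b (fun=> 0 : 'cV[R[i]]_m).
Proof.
move=> ab i; rewrite (_ : (fun t => _) = fun=> 0); last by apply/funext => t; rewrite mxE.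
have mc : measurable_fun `[a, b]%classic (fun _ : R => 0 : R) by exact: measurable_cst.
case: k => [|k].
  split=> //; apply: le_lt_trans (ltry 0); apply/ess_supP; apply: aeT => x.
  by case: ifP; rewrite // /cabs /= expr0n addr0 sqrtr0.
apply/(W_succ_bd ab); exists 0 => e; apply: (bd_eq ab _ (bd0 a b k.+1)) => t _.
by case: e.
Qed.

(** * Fundamental systems and perturbation *)

Section FundamentalSystem.
Context {R : realType} (a b : R) (m k : nat).
Hypothesis ab : a < b.
Notation mu := (@lebesgue_measure R).
Notation C := R[i].
Notation I := ('I_m * bool)%type.
Notation fn := (R -> 'cV[C]_m).
Implicit Types (x M N Q K S : R) (y z f : fn) (A : R -> 'M[C]_m).
Implicit Types (L : fn -> 'cV[C]_m) (F : I -> R -> R) (c d : I) (q v : 'cV[C]_m).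
Implicit Types (al : 'I_m -> 'I_m -> bool -> R -> R).

Local Notation vbd := (vbd a b k.+1).
Local Notation Wvec := (Wvec k.+1 a b).
Local Notation blo := (bounded_linear_op k.+1 a b).

Lemma derive1_lin3 (p r : R) (u v w : R -> R) x : derivable u x 1 ->
  derivable v x 1 -> derivable w x 1 ->
  derive1 (fun t => p * u t + r * v t + w t) x =
  p * derive1 u x + r * derive1 v x + derive1 w x.
Proof.
move=> du dv dw.
have H : is_derive x 1 (fun t => p * u t + r * v t + w t)
    (p * derive1 u x + r * derive1 v x + derive1 w x).
  exact: is_deriveD (is_deriveD (is_deriveZ p (is_derive_derive1 du))
    (is_deriveZ r (is_derive_derive1 dv))) (is_derive_derive1 dw).
by have [_ <-] := H; rewrite derive1E.
Qed.

Lemma Wvec_derivable_ae y : Wvec y ->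
  {ae mu, forall x, x \in `]a, b[ -> forall c, derivable (comp y c) x 1}.
Proof.
move=> /(Wvec_succ ab)[M yM].
have H c : {ae mu, forall x, x \in `]a, b[ -> derivable (comp y c) x 1}.
  have [_ [h hM yh]] := yM c.
  by apply: (aeS _ (bd_derive_ae (bd_bmeas ab hM) yh)) => x Hx /Hx[].
by apply: (aeS _ (ae_fin H)) => x Hx xab c; exact: Hx.
Qed.

(** The derivative is linear where all components are differentiable, which for Lipschitz functions
    is almost everywhere. *)
Lemma Lop_lin_ae A (e : C) y z : Wvec y -> Wvec z ->
  {ae mu, forall x, x \in `]a, b[ ->
    Lop A (fun t => e *: y t + z t) x = e *: Lop A y x + Lop A z x}.
Proof.
move=> /Wvec_derivable_ae dy /Wvec_derivable_ae dz.
apply: (aeS2 _ dy dz) => x Hy Hz xab.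
rewrite /Lop mulmxDr -scalemxAr scalerDr addrACA; congr (_ + _).
apply: cV_comp_eq => c; rewrite -/(comp (vder _) c x) comp_vder.
rewrite (_ : comp _ c = fun t => complex.Re e * comp y c t +
  (if c.2 then 1 else -1) * complex.Im e * comp y (c.1, ~~ c.2) t + comp z c t); last first.
  by apply/funext => t; rewrite comp_lin.
rewrite derive1_lin3; [|exact: Hy|exact: Hy|exact: Hz].
have := @comp_lin _ _ e (fun=> vder y x) (fun=> vder z x) c x.
rewrite /comp => ->; rewrite -/(comp (vder y) c x) -/(comp (vder z) c x).
by rewrite -/(comp (vder y) (c.1, ~~ c.2) x) !comp_vder.
Qed.

Lemma LopB_ae A y z : Wvec y -> Wvec z ->
  {ae mu, forall x, x \in `]a, b[ ->
    Lop A (fun t => y t - z t) x = Lop A y x - Lop A z x}.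
Proof.
move=> yW zW; apply: (aeS _ (Lop_lin_ae A (-1) zW yW)) => x H /H.
rewrite scaleN1r addrC => <-; congr (Lop A _ x).
by apply/funext => t; rewrite scaleN1r addrC.
Qed.

Lemma WvecB y z : Wvec y -> Wvec z -> Wvec (fun t => y t - z t).
Proof.
move=> /(Wvec_succ ab)[M yM] /(Wvec_succ ab)[N zN].
by apply/(Wvec_succ ab); exists (M + N); exact: vbdB.
Qed.

Lemma Wvec_zero_everywhere y : Wvec y ->
  {ae mu, forall x, x \in `[a, b] -> y x = 0} -> forall x, x \in `[a, b] -> y x = 0.
Proof.
move=> /(Wvec_succ ab)[M yM] y0 x xab; apply: cV_comp_eq => c.
rewrite -/(comp y c x) mxE; apply/eqP.
rewrite (_ : part c.2 0 = 0); last by case: c.2.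
rewrite -normr_le0.
have cu := bdS_continuous ab (yM c).
apply: (ae_le_everywhere ab (u := fun x => `|comp y c x|)) => //.
  by move=> t; apply: cvg_norm; exact: cu.
apply: ae_itv_cc_oo; apply: (aeS _ y0) => t H tab.
by rewrite /comp H// mxE; case: c.2; rewrite normr0.
Qed.

Lemma vbd0_eq0 y : vbd 0 y -> forall x, x \in `[a, b] -> y x = 0.
Proof.
move=> y0 x xab; apply: cV_comp_eq => c; rewrite -/(comp y c x) mxE.
rewrite (_ : part c.2 0 = 0); last by case: c.2.
by apply/eqP; rewrite -normr_le0; exact: bd_norm (y0 c) xab.
Qed.

Definition fundamental A (Y : 'I_m -> fn) := forall j,
  [/\ Wvec (Y j), {ae mu, forall x, x \in `]a, b[ -> Lop A (Y j) x = 0} &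
      Y j a = delta_mx j ord0].

Definition combo (Y : 'I_m -> fn) q : fn := fun t => \sum_j q j ord0 *: Y j t.

(** The characteristic matrix of the boundary problem: by [comboP], the combination with
    coefficients [q] satisfies the homogeneous boundary condition exactly when [q] lies in its
    kernel. *)
Definition charmx L (Y : 'I_m -> fn) : 'M[C]_m := \matrix_(i, j) L (Y j) i ord0.

Lemma fundamental_exists A : Wmat k a b A -> exists Y, fundamental A Y.
Proof.
move=> AW; suff /choice[Y YP] : forall j : 'I_m, exists y, [/\ Wvec y,
    {ae mu, forall x, x \in `]a, b[ -> Lop A y x = 0} & y a = delta_mx j ord0].
  by exists Y.
move=> j.
have [y [? ? ?]] := Lop_exists ab (delta_mx j ord0) AW (@Wvec_cst0 _ a b m k ab).
by exists y.
Qed.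

Lemma comboP A Y q : fundamental A Y -> [/\ Wvec (combo Y q),
  {ae mu, forall x, x \in `]a, b[ -> Lop A (combo Y q) x = 0},
  combo Y q a = q & forall L, blo L -> L (combo Y q) = charmx L Y *m q].
Proof.
move=> YA.
(* [bounded_linear_op] gives linearity for two functions at a time, so the combination is built
   along a sequence of indices. *)
have H (r : seq 'I_m) : let w := fun t => \sum_(j <- r) q j ord0 *: Y j t in
    [/\ Wvec w, {ae mu, forall x, x \in `]a, b[ -> Lop A w x = 0} &
      forall L, blo L -> L w = \sum_(j <- r) q j ord0 *: L (Y j)].
  elim: r => [|j r [IHW IHL IHB]] w.
    have -> : w = fun=> 0 by apply/funext => t; rewrite /w big_nil.
    have W0 := @Wvec_cst0 _ a b m k.+1 ab; split=> //.
      (* The zero function equals its difference with itself, so [LopB_ae] sends it to zero. *)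
      have H0 z : (fun t => z t - z t) = z -> Wvec z ->
          {ae mu, forall x, x \in `]a, b[ -> Lop A z x = 0}.
        move=> zz zW; have := LopB_ae A zW zW; rewrite zz.
        by apply: aeS => x E /E; rewrite subrr.
      by apply: H0 => //; apply/funext => t; rewrite subr0.
    by move=> L bL; rewrite big_nil (blo0 ab bL).
  have -> : w = fun t => q j ord0 *: Y j t + \sum_(j <- r) q j ord0 *: Y j t.
    by apply/funext => t; rewrite /w big_cons.
  have [YW YL _] := YA j; split.
  - exact: Wvec_lin.
  - apply: (aeS3 _ (Lop_lin_ae A (q j ord0) YW IHW) YL IHL) => x H1 H2 H3 xab.
    by rewrite H1// H2// H3// scaler0 addr0.
  - by move=> L bL; rewrite (blo_lin _ bL YW IHW) IHB// big_cons.
have [cW cL cB] := H (index_enum 'I_m); split=> //.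
  rewrite /combo; apply/matrixP => i j; rewrite (ord1 j) summxE (bigD1 i)//=.
  rewrite big1 => [|l li].
    by have [_ _ ->] := YA i; rewrite !mxE !eqxx mulr1 addr0.
  by have [_ _ ->] := YA l; rewrite !mxE eq_sym (negbTE li) mulr0.
move=> L bL; rewrite cB//; apply/matrixP => i j; rewrite (ord1 j) summxE mxE.
by apply: eq_bigr => l _; rewrite !mxE mulrC.
Qed.

(** A particular solution vanishing at [a] is corrected by the homogeneous solution that repairs the
    boundary condition. *)
Lemma solves_exists A L Y f v : blo L -> Wmat k a b A -> Defs.Wvec k a b f ->
  fundamental A Y -> charmx L Y \in unitmx ->
  exists y, solves k.+1 a b A L f v y.
Proof.
move=> bL AW fW YA Yu; have [yp [pW pL _]] := Lop_exists ab 0 AW fW.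
have [cW cL _ cB] := comboP (invmx (charmx L Y) *m (v - L yp)) YA.
exists (fun t => 1 *: combo Y (invmx (charmx L Y) *m (v - L yp)) t + yp t); split.
- exact: Wvec_lin.
- apply: (aeS3 _ (Lop_lin_ae A 1 cW pW) cL pL) => x H1 H2 H3 xab.
  by rewrite H1// H2// H3// scaler0 add0r.
- by rewrite (blo_lin 1 bL cW pW) scale1r cB// mulKVmx// subrK.
Qed.

Lemma cvnorm_mulmx (P : 'M[C]_m) v :
  cvnorm (P *m v) <= (\sum_j cvnorm (col j P)) * cvnorm v.
Proof.
have -> : P *m v = \sum_j v j ord0 *: col j P.
  apply/matrixP => i j; rewrite (ord1 j) summxE mxE; apply: eq_bigr => l _.
  by rewrite !mxE mulrC.
apply: le_trans (cvnorm_sum _ _) _; rewrite mulr_suml; apply: ler_sum => j _.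
by rewrite cvnormZ mulrC ler_wpM2l ?cvnorm_ge0 ?cabs_le_cvnorm.
Qed.

(** The leading 1 keeps [K] positive, since [(2 * K)^-1] will be the admissible size of a
    perturbation of [P]. *)
Lemma unitmx_bounded_below (P : 'M[C]_m) : P \in unitmx ->
  exists2 K, 0 < K & forall q, cvnorm q <= K * cvnorm (P *m q).
Proof.
move=> Pu; exists (1 + \sum_j cvnorm (col j (invmx P))).
  by rewrite ltr_wpDr// sumr_ge0// => j _; exact: cvnorm_ge0.
move=> q; rewrite -{1}(mulKmx Pu q); apply: le_trans (cvnorm_mulmx _ _) _.
by rewrite ler_wpM2r ?cvnorm_ge0// lerDr.
Qed.

(** A lower bound makes the kernel trivial. The transpose appears because [kermx] consists of row
    vectors. *)
Lemma bounded_below_unitmx (P : 'M[C]_m) K :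
  (forall q, cvnorm q <= K * cvnorm (P *m q)) -> P \in unitmx.
Proof.
move=> PK; rewrite -unitmx_tr -row_free_unit -kermx_eq0; apply/eqP/row_matrixP => i.
have kP : row i (kermx P^T) *m P^T = 0 by apply/sub_kermxP; exact: row_sub.
rewrite row0; apply: trmx_inj; rewrite trmx0; apply: cvnorm_eq0.
have Pk : P *m (row i (kermx P^T))^T = 0.
  by apply: trmx_inj; rewrite trmx_mul trmxK kP trmx0.
by apply: le_trans (PK _) _; rewrite Pk cvnorm0 mulr0.
Qed.

(* The perturbation [P - P0] of the coefficients enters the equation through
   the forcing term [- (P - P0) y]. *)
Lemma Lop_perturb_rep A A0 be eta y S :
  (forall i j e, bd a b k eta (be i j e)) ->
  (forall i j e, {ae mu, forall x, x \in `[a, b] ->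
     mparts (fun t => A t - A0 t) i j e x = be i j e x}) ->
  vbd S y ->
  exists2 F, forall c, bd a b k (#|{: I}|%:R * (2 ^+ k * (eta * S))) (F c) &
    {ae mu, forall x, x \in `]a, b[ -> forall c,
      part c.2 ((Lop A y x - Lop A0 y x) c.1 ord0) = F c x}.
Proof.
move=> beta_bd Abe yS.
exists (fun c x => \sum_d realmx be c d x * comp y d x) => [c|].
  have -> : #|{: I}|%:R * (2 ^+ k * (eta * S)) = \sum_(d : I) 2 ^+ k * (eta * S).
    by rewrite sumr_const mulr_natl.
  apply: bd_sum => // d; apply: bdM => //; first exact: realmx_bd.
  exact: bd_pred.
have Abe' (p : 'I_m * 'I_m * bool) := Abe p.1.1 p.1.2 p.2.
apply: (aeS _ (ae_fin Abe')) => x H xab c.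
have -> : Lop A y x - Lop A0 y x = (A x - A0 x) *m y x.
  by rewrite /Lop opprD addrACA subrr add0r mulmxBl.
rewrite -/(comp (fun t => (A t - A0 t) *m y t) c x) comp_mulmx.
apply: eq_bigr => d _; congr (_ * _); apply: eq_realmx => i j e.
exact: (H (i, j, e) (subset_itv_oo_cc xab)).
Qed.

End FundamentalSystem.

Section Constants.
Context {R : realType}.
Implicit Types (p r s t K N : R).

(** A lower bound survives a perturbation of size [(2 * K)^-1]: the error is half of [p] and is
    absorbed on the left. *)
Lemma absorb_half K p r : 0 < K -> p <= K * (r + (2 * K)^-1 * p) -> p <= 2 * K * r.
Proof.
move=> K0; have -> : K * (r + (2 * K)^-1 * p) = K * r + p / 2.
  by field; rewrite gt_eqF.
lra.
Qed.

Lemma stability_constant p s t N : 0 <= s -> 0 <= t -> 0 <= N -> 0 <= p ->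
  N + s * (p + t * N) <= (1 + s * (1 + t)) * (N + p).
Proof.
move=> s0 t0 N0 p0; have h1 := mulr_ge0 s0 N0; have h2 := mulr_ge0 (mulr_ge0 s0 t0) p0.
lra.
Qed.

End Constants.

(** * Quantities that vanish with the parameter *)

Section Vanishing.
Context {R : realType}.
Implicit Types (eps d e c : R) (u v : R -> R) (P : R -> Prop).

(** The bounds [e < d] and [e < eps] are kept separate so that [vanishes] unfolds to the exact form
    of the convergence hypotheses. *)
Definition for_small eps P := exists2 d, 0 < d & forall e, 0 < e -> e < d -> e < eps -> P e.

Definition vanishes eps u := forall eta, 0 < eta -> for_small eps (fun e => u e < eta).

Lemma for_small_and eps P Q : for_small eps P -> for_small eps Q ->
  for_small eps (fun e => P e /\ Q e).
Proof.
move=> [d d0 Pd] [d' d'0 Qd]; exists (Num.min d d'); first by rewrite lt_min d0.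
by move=> e e0; rewrite lt_min => /andP[ed ed'] ee; split; [exact: Pd|exact: Qd].
Qed.

Lemma for_small_imp eps P Q : (forall e, 0 < e -> e < eps -> P e -> Q e) ->
  for_small eps P -> for_small eps Q.
Proof.
by move=> PQ [d d0 Pd]; exists d => // e e0 ed ee; apply: PQ => //; exact: Pd.
Qed.

Lemma for_small_le eps eps' P : eps' <= eps -> for_small eps P -> for_small eps' P.
Proof.
move=> ee [d d0 Pd]; exists d => // e e0 ed ee'.
by apply: Pd => //; exact: lt_le_trans ee' ee.
Qed.

Lemma for_small_itv eps P : 0 < eps -> for_small eps P ->
  exists2 d, 0 < d <= eps & forall e, 0 < e -> e < d -> P e.
Proof.
move=> eps0 [d d0 Pd]; exists (Num.min d eps); first by rewrite lt_min d0 eps0 ge_min lexx orbT.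
by move=> e e0; rewrite lt_min => /andP[? ?]; exact: Pd.
Qed.

Lemma vanishes_restrict eps eps' u : eps' <= eps -> vanishes eps u -> vanishes eps' u.
Proof. by move=> ee vu eta /vu; exact: for_small_le. Qed.

Lemma vanishes_le eps u v : (forall e, 0 < e -> e < eps -> u e <= v e) ->
  vanishes eps v -> vanishes eps u.
Proof.
move=> uv vv eta /vv; apply: for_small_imp => e e0 ee; exact: le_lt_trans (uv _ e0 ee).
Qed.

Lemma vanishesD eps u v : vanishes eps u -> vanishes eps v ->
  vanishes eps (fun e => u e + v e).
Proof.
move=> vu vv eta eta0; have e20 : 0 < eta / 2 by rewrite divr_gt0.
apply: for_small_imp (for_small_and (vu _ e20) (vv _ e20)) => e _ _ [ue ve].
by rewrite [eta]splitr ltrD.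
Qed.

Lemma vanishesZ eps c u : 0 <= c -> (forall e, 0 < e -> e < eps -> 0 <= u e) ->
  vanishes eps u -> vanishes eps (fun e => c * u e).
Proof.
move=> c0 u0 vu eta eta0; have c1 : 0 < c + 1 by rewrite ltr_wpDl.
have := vu (eta / (c + 1)) (divr_gt0 eta0 c1); apply: for_small_imp => e e0 ee.
rewrite ltr_pdivlMr// mulrC => H; apply: le_lt_trans H.
by rewrite ler_wpM2r ?u0// lerDl.
Qed.

Lemma vanishes_cst0 eps : vanishes eps (fun=> 0).
Proof. by move=> eta eta0; exists 1. Qed.

Lemma vanishes_sum (J : Type) (r : seq J) eps (u : J -> R -> R) :
  (forall j, vanishes eps (u j)) -> vanishes eps (fun e => \sum_(j <- r) u j e).
Proof.
move=> vu; elim: r => [|j r IH].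
  by apply: vanishes_le (vanishes_cst0 eps) => e _ _; rewrite big_nil.
by apply: vanishes_le (vanishesD (vu j) IH) => e _ _; rewrite big_cons.
Qed.

End Vanishing.

(** * Stability uniform in the parameter *)

Section Perturbation.
Context {R : realType} (a b : R) (m k : nat).
Hypothesis ab : a < b.
Notation mu := (@lebesgue_measure R).
Notation C := R[i].
Notation I := ('I_m * bool)%type.
Notation fn := (R -> 'cV[C]_m).
Implicit Types (x e d M N Q K S eps : R) (y z f : fn).
Implicit Types (F : I -> R -> R) (c : I) (q v : 'cV[C]_m).
Implicit Types (al be : 'I_m -> 'I_m -> bool -> R -> R).

Local Notation vbd := (vbd a b k.+1).
Local Notation Wvec := (Wvec k.+1 a b).
Local Notation blo := (bounded_linear_op k.+1 a b).

Lemma Wnorm_ge0 j (g : R -> C) : 0 <= Wnorm j a b g.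
Proof. by apply: sumr_ge0 => i _; rewrite fine_ge0// Linf_norm_ge0. Qed.

Lemma Wvec_norm_ge0 j y : 0 <= Wvec_norm j a b y.
Proof. by apply: sumr_ge0 => i _; exact: Wnorm_ge0. Qed.

Lemma Wmat_norm_ge0 j (A : R -> 'M[C]_m) : 0 <= Wmat_norm j a b A.
Proof. by apply: sumr_ge0 => i _; apply: sumr_ge0 => ? _; exact: Wnorm_ge0. Qed.

Lemma agreeB j (f g u v : R -> R) : agree a b j f u -> agree a b j g v ->
  agree a b j (fun x => f x - g x) (fun x => u x - v x).
Proof.
case: j => [|j] fu gv; last by move=> x xab; rewrite fu// gv.
by apply: (aeS2 _ fu gv) => x H1 H2 xab; rewrite H1// H2.
Qed.

Lemma Wmat_diff_rep (A A' : R -> 'M[C]_m) : Wmat k a b A -> Wmat k a b A' ->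
  exists2 be, forall i j s, bd a b k (Wmat_norm k a b (fun t => A t - A' t)) (be i j s) &
    forall i j s, {ae mu, forall x, x \in `[a, b] ->
      mparts (fun t => A t - A' t) i j s x = be i j s x}.
Proof.
move=> /(Wmat_rep ab)[M [al alM Aal]] /(Wmat_rep ab)[M' [al' al'M' Aal']].
pose D i j s x := al i j s x - al' i j s x.
have DM i j s : bd a b k (M + M') (D i j s) by exact: bdB.
have AD i j s : agree a b k (mparts (fun t => A t - A' t) i j s) (D i j s).
  have := agreeB (Aal i j s) (Aal' i j s); congr agree; apply/funext => x.
  by rewrite /mparts !mxE; case: s; rewrite /= raddfB.
have [be beW beD] := Wmat_norm_rep ab AD DM.
exists be => // i j s; apply: (aeS2 _ (beD i j s) (agree_ae (AD i j s))) => x H1 H2 xab.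
by rewrite H2// H1.
Qed.

Lemma Wvec_diff_rep f g : Defs.Wvec k a b f -> Defs.Wvec k a b g ->
  exists2 F, forall c, bd a b k (Wvec_norm k a b (fun t => f t - g t)) (F c) &
    forall c, {ae mu, forall x, x \in `[a, b] -> comp (fun t => f t - g t) c x = F c x}.
Proof.
move=> /(Wvec_rep ab)[M [u uM fu]] /(Wvec_rep ab)[N [v vN gv]].
pose D c x := u c x - v c x.
have DM c : bd a b k (M + N) (D c) by exact: bdB.
have fD c : agree a b k (comp (fun t => f t - g t) c) (D c).
  have := agreeB (fu c) (gv c); congr agree; apply/funext => x.
  by rewrite compB.
have [F FW FD] := Wvec_norm_rep ab fD DM.
exists F => // c; apply: (aeS2 _ (FD c) (agree_ae (fD c))) => x H1 H2 xab.
by rewrite H2// H1.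
Qed.

Variables (eps0 : R) (A : R -> R -> 'M[C]_m) (B : R -> fn -> 'cV[C]_m).
Hypothesis eps0_gt0 : 0 < eps0.
Hypothesis AW : forall e, 0 <= e -> e < eps0 -> Wmat k a b (A e).
Hypothesis bB : forall e, 0 <= e -> e < eps0 -> blo (B e).
Hypothesis trivial0 : forall y, solves k.+1 a b (A 0) (B 0) (fun=> 0) 0 y ->
  {ae mu, forall x, x \in `[a, b] -> y x = 0}.
Let eta e := Wmat_norm k a b (fun t => A e t - A 0 t).
Hypothesis A_cvg : vanishes eps0 eta.
Hypothesis B_cvg : forall y, Wvec y -> vanishes eps0 (fun e => cvnorm (B e y - B 0 y)).

(** The right-hand side enters through real functions [F], which can be chosen bounded at every
    point. *)
Definition forced e y F := forall c,
  {ae mu, forall x, x \in `]a, b[ -> comp (Lop (A e) y) c x = F c x}.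

(** As soon as [eta e < 1], the coefficients at [e] have representatives bounded by [M + 1], where
    [M] is a bound at zero; the constant belonging to [M + 1] then serves all these parameters. *)
Lemma uniform_apriori : exists2 d, 0 < d <= eps0 & exists2 K, 0 <= K &
  forall e, 0 <= e -> e < d -> forall y F N Q, Wvec y ->
    (forall c, bd a b k N (F c)) -> forced e y F -> cvnorm (y a) <= Q ->
    vbd (K * (N + Q)) y.
Proof.
have W0 := AW (lexx 0) eps0_gt0.
have [M [al alM Aal]] := Wmat_rep ab W0.
have Aal' i j s := agree_ae (Aal i j s).
have [K K0 HK] := Lop_apriori m k ab (M + 1).
have [d /andP[d0 de] Hd] := for_small_itv eps0_gt0 (A_cvg ltr01).
exists d; first by rewrite d0.
exists K => // e; rewrite le_eqVlt => /predU1P[<-|e0] ed y F N Q yW FN LF yQ.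
  apply: HK Aal' yW FN LF yQ => i j e'; apply: bd_le (alM i j e').
  by rewrite lerDl.
have ee : e < eps0 := lt_le_trans ed de.
have [be beW Abe] := Wmat_diff_rep (AW (ltW e0) ee) W0.
apply: (HK (A e) (fun i j s x => al i j s x + be i j s x)) yW FN LF yQ => i j e'.
  by apply: bd_le (bdD ab (alM i j e') (beW i j e')); rewrite lerD2l ltW// Hd.
apply: (aeS2 _ (Aal' i j e') (Abe i j e')) => x H1 H2 xab; rewrite -H1// -H2//.
by rewrite /mparts !mxE; move: H1 H2 => _ _; case: e'; rewrite /= raddfB/= subrKC.
Qed.

(** A kernel vector gives a solution of the homogeneous problem. It vanishes almost everywhere,
    hence by continuity at [a], where its value is that vector. *)
Lemma charmx0_unit Y : fundamental a b k (A 0) Y -> charmx (B 0) Y \in unitmx.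
Proof.
move=> YA; have bB0 := bB (lexx 0) eps0_gt0.
rewrite -unitmx_tr -row_free_unit -kermx_eq0; apply/eqP/row_matrixP => i.
have kP : row i (kermx (charmx (B 0) Y)^T) *m (charmx (B 0) Y)^T = 0.
  by apply/sub_kermxP; exact: row_sub.
rewrite row0; set r := row i _ in kP *.
have [cW cL ca cB] := comboP ab r^T YA.
have s0 : solves k.+1 a b (A 0) (B 0) (fun=> 0) 0 (combo Y r^T).
  split=> //; rewrite cB//; apply: trmx_inj.
  by rewrite trmx_mul trmxK kP trmx0.
have := Wvec_zero_everywhere ab cW (trivial0 s0) (left_in_itv ab).
by rewrite ca => /(congr1 trmx); rewrite trmxK trmx0.
Qed.

(** Invertibility of the characteristic matrix includes [e = 0], where the limit solution has to
    exist; the estimate concerns positive [e], the range of the uniform bound on [B e]. *)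
Lemma uniform_stability : exists2 d, 0 < d <= eps0 & exists2 K, 0 <= K &
  (forall e, 0 <= e -> e < d -> exists2 Y, fundamental a b k (A e) Y &
     charmx (B e) Y \in unitmx) /\
  forall e, 0 < e -> e < d -> forall y F N, Wvec y -> 0 <= N ->
    (forall c, bd a b k N (F c)) -> forced e y F ->
    vbd (K * (N + cvnorm (B e y))) y.
Proof.
have [d1 /andP[d10 d1e] [K K0 HK]] := uniform_apriori.
have [d2 /andP[d20 d2e] [KB KB0 HB]] := uniform_boundedness ab eps0_gt0 bB B_cvg.
pose eps1 := Num.min d1 d2.
have eps1_gt0 : 0 < eps1 by rewrite lt_min d10.
have eps1e : eps1 <= eps0 by rewrite ge_min d1e.
have lt1 e : e < eps1 -> [/\ e < d1, e < d2 & e < eps0].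
  move=> ee; have := ee; rewrite lt_min => /andP[? ?]; split=> //.
  exact: lt_le_trans ee eps1e.
have /choice[Y YP] : forall e, exists Y, 0 <= e -> e < eps0 -> fundamental a b k (A e) Y.
  move=> e; have [e0|e0] := leP 0 e; last by exists (fun=> fun=> 0).
  have [ee|ee] := ltP e eps0; last by exists (fun=> fun=> 0).
  by have [Y YA] := fundamental_exists ab (AW e0 ee); exists Y.
have Y0 := YP 0 (lexx 0) eps0_gt0.
pose P e := charmx (B e) (Y e).
have [K1 K10 HK1] := unitmx_bounded_below (charmx0_unit Y0).
(* No forcing and an initial value of norm 1 give the bound [K * (0 + 1)]. *)
have Ycol e j : 0 <= e -> e < eps1 -> vbd K (Y e j).
  move=> e0 /lt1[ed1 _ ee]; have [YW YL Ya] := YP e e0 ee j.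
  rewrite -[K]mulr1 -[1]add0r.
  apply: (HK e e0 ed1 (Y e j) (fun _ _ => 0)) => //; first by move=> c; exact: bd0.
    by move=> c; apply: (aeS _ YL) => x H xab; rewrite /comp H// mxE; case: c.2.
  rewrite Ya /cvnorm (bigD1 j)//= big1 => [|i ij].
    by rewrite mxE !eqxx addr0 /cabs /= expr1n expr0n addr0 sqrtr1.
  by rewrite mxE (negbTE ij) /cabs /= expr0n addr0 sqrtr0.
(* The difference vanishes at [a] and solves the equation at [e] with forcing
   [- (A e - A 0) *m Y 0 j], of size [eta e]. *)
have Ydiff e j : 0 < e -> e < eps1 ->
    vbd (K * (#|{: I}|%:R * (2 ^+ k * (eta e * K)))) (fun t => Y e j t - Y 0 j t).
  move=> e0 ee1; have [ed1 _ ee] := lt1 e ee1.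
  have [be beW Abe] := Wmat_diff_rep (AW (ltW e0) ee) (AW (lexx 0) eps0_gt0).
  have [F FN LF] := Lop_perturb_rep ab beW Abe (Ycol 0 j (lexx 0) eps1_gt0).
  have [YW YL Ya] := YP e (ltW e0) ee j; have [Y0W Y0L Y0a] := Y0 j.
  rewrite -[X in K * X]addr0.
  apply: (HK e (ltW e0) ed1 _ (fun c x => - F c x)).
  - exact: WvecB.
  - by move=> c; exact: bdN.
  - move=> c; have LB := LopB_ae ab (A e) YW Y0W.
    have {}LB : {ae mu, forall x, x \in `]a, b[ -> Lop (A e) (fun t => Y e j t - Y 0 j t) x =
        - (Lop (A e) (Y 0 j) x - Lop (A 0) (Y 0 j) x)}.
      apply: (aeS3 _ LB YL Y0L) => x H1 H2 H3 xab.
      by rewrite H1// H2// H3// subr0 sub0r.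
    apply: (aeS2 _ LB LF) => x H1 H2 xab.
    rewrite /comp H1// -(H2 xab c) [in LHS]mxE.
    by case: c.2; rewrite /= raddfN.
  - by rewrite Ya Y0a subrr cvnorm0.
have eta0 e : 0 <= eta e by exact: Wmat_norm_ge0.
have Pcvg : vanishes eps1 (fun e => \sum_j cvnorm (col j (P e - P 0))).
  apply: vanishes_sum => j; have [Y0W _ _] := Y0 j.
  have vB := vanishes_restrict eps1e (B_cvg Y0W).
  have v1 : vanishes eps1 (fun e => KB * (K * (#|{: I}|%:R * (2 ^+ k * K))) * eta e).
    apply: vanishesZ => //; last exact: vanishes_restrict A_cvg.
    by rewrite !mulr_ge0// exprn_ge0.
  apply: vanishes_le (vanishesD v1 vB) => e e0 ee1; have [ed1 ed2 ee] := lt1 e ee1.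
  have [YW _ _] := YP e (ltW e0) ee j.
  have -> : col j (P e - P 0) = B e (fun t => Y e j t - Y 0 j t) +
      (B e (Y 0 j) - B 0 (Y 0 j)).
    rewrite (bloB (bB (ltW e0) ee) YW Y0W) addrA subrK.
    by apply/matrixP => i l; rewrite (ord1 l) !mxE.
  apply: le_trans (cvnormD _ _) _; rewrite lerD2r.
  apply: le_trans (HB e e0 ed2 _ _ _ (Ydiff e j e0 ee1)) _.
    by rewrite !mulr_ge0// exprn_ge0.
  by rewrite -!mulrA ler_wpM2l// ler_wpM2l// ler_wpM2l// ler_wpM2l// mulrC.
have K1' : 0 < (2 * K1)^-1 by rewrite invr_gt0 mulr_gt0.
have [d /andP[d0 de] Hd] := for_small_itv eps1_gt0 (Pcvg _ K1').
(* The lower bound for [P 0] passes to [P e] with twice the constant, because [P e - P 0] has size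
   below [(2 * K1)^-1]. *)
have below e : 0 < e -> e < d -> forall q, cvnorm q <= 2 * K1 * cvnorm (P e *m q).
  move=> e0 ed q; have H1 := HK1 q.
  have H2 : cvnorm (P 0 *m q) <= cvnorm (P e *m q) + (2 * K1)^-1 * cvnorm q.
    have -> : P 0 *m q = P e *m q - (P e - P 0) *m q by rewrite mulmxBl opprB addrC subrK.
    apply: le_trans (cvnormB _ _) _; rewrite lerD2l.
    apply: le_trans (cvnorm_mulmx _ _) _.
    by rewrite ler_wpM2r ?cvnorm_ge0// ltW// Hd.
  exact: absorb_half K10 (le_trans H1 (ler_wpM2l (ltW K10) H2)).
exists d; first by rewrite d0 (le_trans de).
exists (K * (1 + 2 * K1 * (1 + KB * K))).
  by rewrite mulr_ge0// addr_ge0// !mulr_ge0 ?(ltW K10)// addr_ge0// mulr_ge0.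
split=> [e|e e0 ed y F N yW N0 FN LF].
  rewrite le_eqVlt => /predU1P[<- _|e0 ed]; first by exists (Y 0) => //; exact: charmx0_unit.
  have ee1 := lt_le_trans ed de; have [_ _ ee] := lt1 e ee1.
  by exists (Y e); [apply: YP => //; exact: ltW|exact: bounded_below_unitmx (below e e0 ed)].
have ee1 := lt_le_trans ed de; have [ed1 ed2 ee] := lt1 e ee1.
have [cW cL ca cB] := comboP ab (y a) (YP e (ltW e0) ee).
have be := bB (ltW e0) ee.
(* Subtracting the homogeneous solution with the same value at [a] leaves a function controlled by
   the forcing alone. *)
have zK : vbd (K * (N + 0)) (fun t => y t - combo (Y e) (y a) t).
  apply: (HK e (ltW e0) ed1 _ F) => //; first exact: WvecB.
  - move=> c; apply: (aeS3 _ (LopB_ae ab (A e) yW cW) cL (LF c)) => x H1 H2 H3 xab.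
    by rewrite /comp H1// H2// subr0; exact: H3.
  - by rewrite ca subrr cvnorm0.
rewrite addr0 in zK.
have Bz := HB e e0 ed2 _ _ (mulr_ge0 K0 N0) zK.
(* The initial value is recovered from the boundary data: [P e *m y a] is [B e y] minus [B e] of the
   part just estimated. *)
have qb : cvnorm (y a) <= 2 * K1 * (cvnorm (B e y) + KB * (K * N)).
  apply: le_trans (below e e0 ed (y a)) _.
  rewrite ler_wpM2l ?mulr_ge0 ?(ltW K10)//.
  have -> : P e *m y a = B e y - B e (fun t => y t - combo (Y e) (y a) t).
    by rewrite (bloB be yW cW) cB// opprB addrC subrK.
  by apply: le_trans (cvnormB _ _) _; rewrite lerD2l.
apply: vbd_le (HK e (ltW e0) ed1 y F N _ yW FN LF qb).
rewrite -[leRHS]mulrA ler_wpM2l//.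
rewrite (mulrA KB); apply: stability_constant => //; last exact: cvnorm_ge0.
  by rewrite mulr_ge0 ?ltW.
exact: mulr_ge0.
Qed.

End Perturbation.

(** * Invertibility and convergence of the solutions *)

Lemma Wvec_norm_vbd {R : realType} (a b : R) m k M (y : R -> 'cV[R[i]]_m) : a < b ->
  vbd a b k M y -> Wvec_norm k a b y <= m%:R * (k.+1%:R * 2) * M.
Proof.
move=> ab yM; rewrite -!mulrA; apply: (Wvec_norm_le ab _ yM) => c.
exact: agree_refl.
Qed.

(** Existence of the solutions, at [e = 0] included, is asserted together with their convergence;
    uniqueness for small positive [e] is contained in [LB_invertible]. *)
Theorem theorem3 (R : realType) (a b : R) (m n : nat) (eps0 : R)
  (A : R -> R -> 'M[R[i]]_m) (f : R -> R -> 'cV[R[i]]_m)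
  (c : R -> 'cV[R[i]]_m) (B : R -> (R -> 'cV[R[i]]_m) -> 'cV[R[i]]_m) :
  a < b -> (0 < n)%N -> 0 < eps0 ->
  (forall e, 0 <= e -> e < eps0 ->
     [/\ Wmat n.-1 a b (A e), Wvec n.-1 a b (f e) &
         bounded_linear_op n a b (B e)]) ->
  (* the homogeneous problem at eps = 0 has only the trivial solution *)
  (forall y, solves n a b (A 0) (B 0) (fun _ => 0) 0 y ->
     {ae @lebesgue_measure R, forall x, x \in `[a, b] -> y x = 0}) ->
  (* 1) *)
  (forall eta, 0 < eta -> exists2 d, 0 < d & forall e, 0 < e -> e < d -> e < eps0 ->
     Wmat_norm n.-1 a b (fun x => A e x - A 0 x) < eta) ->
  (* 2) *)
  (forall y, Wvec n a b y ->
     forall eta, 0 < eta -> exists2 d, 0 < d & forall e, 0 < e -> e < d -> e < eps0 ->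
       cvnorm (B e y - B 0 y) < eta) ->
  (exists2 d, 0 < d <= eps0 &
     forall e, 0 < e -> e < d -> LB_invertible n a b (A e) (B e)) /\
  ((* 3) *)
   (forall eta, 0 < eta -> exists2 d, 0 < d & forall e, 0 < e -> e < d -> e < eps0 ->
      Wvec_norm n.-1 a b (fun x => f e x - f 0 x) < eta) ->
   (forall eta, 0 < eta -> exists2 d, 0 < d & forall e, 0 < e -> e < d -> e < eps0 ->
      cvnorm (c e - c 0) < eta) ->
   exists2 d, 0 < d <= eps0 &
     exists y : R -> R -> 'cV[R[i]]_m,
       (forall e, 0 <= e -> e < d -> solves n a b (A e) (B e) (f e) (c e) (y e)) /\
       (forall eta, 0 < eta -> exists2 d', 0 < d' & forall e, 0 < e -> e < d' -> e < d ->
          Wvec_norm n a b (fun x => y e x - y 0 x) < eta)).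
Proof.
move=> ab; case: n => // k _ eps0_gt0 HW trivial0 A_cvg B_cvg.
have AW e : 0 <= e -> e < eps0 -> Wmat k a b (A e) by move=> e0 ee; have [] := HW e e0 ee.
have fW e : 0 <= e -> e < eps0 -> Wvec k a b (f e) by move=> e0 ee; have [] := HW e e0 ee.
have bB e : 0 <= e -> e < eps0 -> bounded_linear_op k.+1 a b (B e).
  by move=> e0 ee; have [] := HW e e0 ee.
have [d /andP[d0 de] [K K0 [unit_charmx stable]]] :=
  uniform_stability ab eps0_gt0 AW bB trivial0 A_cvg B_cvg.
have lte e : e < d -> e < eps0 by move=> ed; exact: lt_le_trans ed de.
have solvable e g v : 0 <= e -> e < d -> Wvec k a b g ->
    exists y, solves k.+1 a b (A e) (B e) g v y.
  move=> e0 ed gW; have [Y YA Yu] := unit_charmx e e0 ed.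
  by apply: solves_exists YA Yu => //; [apply: bB|apply: AW] => //; exact: lte.
have forcedB e g y : {ae @lebesgue_measure R, forall x, x \in `]a, b[ -> Lop (A e) y x = g x} ->
    forall F, (forall c', {ae @lebesgue_measure R, forall x, x \in `[a, b] ->
      comp g c' x = F c' x}) -> forced a b A e y F.
  move=> yg F gF c'; apply: (aeS2 _ yg (gF c')) => x H1 H2 xab.
  by rewrite /comp H1//; exact: H2 (subset_itv_oo_cc xab).
split.
  exists d; first by rewrite d0.
  move=> e e0 ed; have ee := lte e ed; split.
  - by move=> g v; apply: solvable => //; exact: ltW.
  - move=> g v y1 y2 [W1 L1 B1] [W2 L2 B2].
    have LB : {ae @lebesgue_measure R, forall x, x \in `]a, b[ ->
        Lop (A e) (fun t => y1 t - y2 t) x = 0}.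
      apply: (aeS3 _ (LopB_ae ab (A e) W1 W2) L1 L2) => x H1 H2 H3 xab.
      by rewrite H1// H2// H3// subrr.
    (* Zero data in the stability estimate give the bound zero, so the two solutions agree at every
       point of [[a, b]]. *)
    have := stable e e0 ed (fun t => y1 t - y2 t) (fun _ _ => 0) 0 (WvecB ab W1 W2) (lexx _).
    rewrite (bloB (bB e (ltW e0) ee) W1 W2) B1 B2 subrr cvnorm0 addr0 mulr0 => H.
    apply: aeT => x xab; apply/eqP; rewrite -subr_eq0; apply/eqP.
    apply: (vbd0_eq0 (H _ _) xab) => [c'|c']; first exact: bd0.
    by apply: (aeS _ LB) => t Ht tab; rewrite /comp Ht// mxE; case: c'.2.
  - exists (m%:R * (k.+2%:R * 2) * K) => y yW.
    have [S yS] := (Wvec_succ ab k y).1 yW.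
    have [M [al alM Aal]] := Wmat_rep ab (AW e (ltW e0) ee).
    have [F FM LF] := Lop_rep ab alM Aal yS.
    (* [F'] represents [Lop (A e) y] almost everywhere and is bounded by its Sobolev norm, as the
       estimate of the inverse requires. *)
    have [F' F'W F'F] := Wvec_norm_rep ab LF FM.
    have yf : forced a b A e y F'.
      move=> c'; apply: (aeS2 _ (agree_ae (LF c')) (F'F c')) => x H1 H2 xab.
      by rewrite H1 ?H2 ?(subset_itv_oo_cc xab).
    have := stable e e0 ed y F' _ yW (Wvec_norm_ge0 ab _ _) F'W yf.
    by move=> /(Wvec_norm_vbd ab) /le_trans; apply; rewrite -[leRHS]mulrA.
move=> f_cvg c_cvg; exists d; first by rewrite d0.
have /choice[y yP] : forall e, exists y, 0 <= e -> e < d ->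
    solves k.+1 a b (A e) (B e) (f e) (c e) y.
  move=> e; have [e0|e0] := leP 0 e; last by exists (fun=> 0).
  have [ed|ed] := ltP e d; last by exists (fun=> 0).
  have [y yP] := solvable e (f e) (c e) e0 ed (fW e e0 (lte e ed)).
  by exists y.
exists y; split=> //; have [y0W y0L y0B] := yP 0 (lexx _) d0.
have [S y0S] := (Wvec_succ ab k (y 0)).1 y0W.
pose eta e := Wmat_norm k a b (fun t => A e t - A 0 t).
(* The difference [y e - y 0] solves the problem at [e] with forcing
   [f e - f 0 - (A e - A 0) *m y 0] and boundary value [(c e - c 0) - (B e (y 0) - B 0 (y 0))];
   [rho] bounds the size of these data. The absolute value of [S] makes [D] visibly nonnegative. *)
pose D := #|{: 'I_m * bool}|%:R * (2 ^+ k * `|S|).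
pose rho e := Wvec_norm k a b (fun t => f e t - f 0 t) + D * eta e +
  (cvnorm (c e - c 0) + cvnorm (B e (y 0) - B 0 (y 0))).
have rho_cvg : vanishes d rho.
  apply: (vanishes_restrict de); apply: vanishesD; last exact: vanishesD (B_cvg _ y0W).
  apply: vanishesD => //; apply: vanishesZ => //; first by rewrite !mulr_ge0// exprn_ge0.
  by move=> e _ _; exact: Wmat_norm_ge0.
suff bound e : 0 < e -> e < d ->
    Wvec_norm k.+1 a b (fun x => y e x - y 0 x) <= m%:R * (k.+2%:R * 2) * K * rho e.
  apply: (vanishes_le bound); apply: vanishesZ => //; first by rewrite !mulr_ge0.
  move=> e _ _; rewrite !addr_ge0 ?cvnorm_ge0 ?Wvec_norm_ge0//.
  by rewrite !mulr_ge0 ?exprn_ge0 ?Wmat_norm_ge0.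
move=> e0 ed; have ee := lte e ed; have [yW yL yB] := yP e (ltW e0) ed.
have [Ff FfW Fff] := Wvec_diff_rep ab (fW e (ltW e0) ee) (fW 0 (lexx _) eps0_gt0).
have [be beW Abe] := Wmat_diff_rep ab (AW e (ltW e0) ee) (AW 0 (lexx _) eps0_gt0).
have [G GN LG] := Lop_perturb_rep ab beW Abe (vbd_le (ler_norm S) y0S).
have zF : forced a b A e (fun t => y e t - y 0 t) (fun c' x => Ff c' x - G c' x).
  move=> c'; have LB : {ae @lebesgue_measure R, forall x, x \in `]a, b[ ->
      Lop (A e) (fun t => y e t - y 0 t) x =
      (f e x - f 0 x) - (Lop (A e) (y 0) x - Lop (A 0) (y 0) x)}.
    apply: (aeS3 _ (LopB_ae ab (A e) yW y0W) yL y0L) => x H1 H2 H3 xab.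
    by rewrite H1// H2// H3// opprB addrA subrK.
  apply: (aeS3 _ LB (Fff c') LG) => x H1 H2 H3 xab.
  rewrite -(H3 xab c') -H2 ?(subset_itv_oo_cc xab)// /comp H1// [in LHS]mxE.
  by rewrite [X in _ + X]mxE; case: c'.2; rewrite /= raddfB.
have := stable e e0 ed _ _ (Wvec_norm k a b (fun t => f e t - f 0 t) + D * eta e)
  (WvecB ab yW y0W) _ _ zF.
rewrite (bloB (bB e (ltW e0) ee) yW y0W) yB => H.
have Ge c' : bd a b k (D * eta e) (G c').
  by apply: bd_le (GN c'); rewrite /D -!mulrA (mulrC `|S|).
have {H} := H _ (fun c' => bdB ab (FfW c') (Ge c')).
have N0 : 0 <= Wvec_norm k a b (fun t => f e t - f 0 t) + D * eta e.
  by rewrite addr_ge0 ?Wvec_norm_ge0// !mulr_ge0 ?exprn_ge0 ?Wmat_norm_ge0.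
move=> /(_ N0) /(Wvec_norm_vbd ab) /le_trans; apply.
rewrite -[leRHS]mulrA !ler_wpM2l ?mulr_ge0// lerD2l.
rewrite (_ : c e - B e (y 0) = (c e - c 0) - (B e (y 0) - B 0 (y 0))); last first.
  by rewrite y0B opprB addrA subrK.
exact: cvnormB.
Qed.
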